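(* Let $j,r\ge 0$ and $k\ge 1$ be integers with $j+r\le k$. Then \[ \sum_{s_1\ge\cdots\ge s_k\ge 0}\frac{q^{2(s_1^2+\cdots+s_k^2-s_1-\cdots-s_j+s_{k-r+1}+\cdots+s_k)}(-q^{1+2s_k};q^2)_\infty}{(q^2;q^2)_{s_1-s_2}\cdots(q^2;q^2)_{s_{k-1}-s_k}(q^2;q^2)_{s_k}} =\frac{(-q^3;q^2)_\infty}{(q^2;q^2)_\infty}\sum_{s=0}^{j}\Big((q^{4k+4},q^{2k+3-2r+2j-4s},q^{2k+1+2r-2j+4s};q^{4k+4})_\infty+q\,(q^{4k+4},q^{2k+1-2r+2j-4s},q^{2k+3+2r-2j+4s};q^{4k+4})_\infty\Big). \]
   Context: $q$ is a complex number with $|q|<1$. $(a;q)_\infty=\prod_{m\ge0}(1-aq^m)$, $(a;q)_n=(a;q)_\infty/(aq^n;q)_\infty$, $(a_1,\dots,a_m;q)_\infty=\prod_i(a_i;q)_\infty$. $s_1+\cdots+s_j=\sum_{i=1}^j s_i$ and $s_{k-r+1}+\cdots+s_k=\sum_{i=k-r+1}^k s_i$ (empty sums are $0$). *)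

(* Defs.v *)
From mathcomp Require Import all_boot all_order all_algebra.
From mathcomp Require Import finmap classical_sets reals topology normedtype sequences.
From mathcomp Require Import summability.

Set Implicit Arguments.
Unset Strict Implicit.
Unset Printing Implicit Defensive.

Import Order.TTheory GRing.Theory Num.Theory.
Import numFieldNormedType.Exports.

Local Open Scope classical_set_scope.
Local Open Scope ring_scope.

(* The definitions are over any numFieldType, so that they use its norm topology;
   they are meant for the complex numbers K = R[i] with R : realType, where the
   norm is the modulus. *)

Section QPochhammer.
Variable K : numFieldType.
Implicit Types a q : K.

(* [lim] is a total function, but for `|q| < 1 the partial products do
   converge, so it is the value of the infinite product. *)
Definition qpoch_inf a q : K :=
  lim ((fun n : nat => \prod_(m < n) (1 - a * q ^+ m)) @ \oo).

(* The divisor vanishes when a q^(n+m) = 1 for some m, in which case the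
   quotient is 0 by convention; for `|a| < 1 and `|q| < 1 it does not. *)
Definition qpoch a q (n : nat) : K :=
  qpoch_inf a q / qpoch_inf (a * q ^+ n) q.

Definition qpochs_inf (s : seq K) q : K := \prod_(a <- s) qpoch_inf a q.

End QPochhammer.

(* The entries of s are numbered from 1, and part s i = 0 for i > k. *)
Definition part (k : nat) (s : k.-tuple nat) (i : nat) : nat := nth 0%N s i.-1.

Section MultipleSum.
Variable K : numFieldType.

(* Half the exponent of q: s_1^2 + ... + s_k^2 - (s_1 + ... + s_j)
   + (s_{k-r+1} + ... + s_k).  For j <= k and r <= k no subtraction in nat is
   truncated, since s_i <= s_i^2. *)
Definition half_exponent (k j r : nat) (s : k.-tuple nat) : nat :=
  (\sum_(1 <= i < k.+1) part s i ^ 2 - \sum_(1 <= i < j.+1) part s i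
   + \sum_(k - r + 1 <= i < k.+1) part s i)%N.

Definition summand (k j r : nat) (q : K) (s : k.-tuple nat) : K :=
  q ^+ (2 * half_exponent j r s)
  * qpoch_inf (- q ^+ (1 + 2 * part s k)) (q ^+ 2)
  / ((\prod_(1 <= i < k) qpoch (q ^+ 2) (q ^+ 2) (part s i - part s i.+1))
     * qpoch (q ^+ 2) (q ^+ 2) (part s k)).

End MultipleSum.

Definition chain (k : nat) := {s : k.-tuple nat | sorted geq s}.

(* Unconditional summation: the net of the sums of f over the finite subsets of
   I, ordered by inclusion, converges to l. *)
Definition has_sum (K : numFieldType) (I : choiceType) (f : I -> K) (l : K) :=
  (partial_sum f @ totally --> l).

(* Main.v *)
(* Put Q = q^2 and (-q^(1+2s);Q)_oo = (-q;Q)_oo / (-q;Q)_s, and truncate the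
   outermost sum, weighting the term s_1 by 1/(Q;Q)_(n-s_1).  The multiple sum
   becomes f |-> (n |-> sum_(s <= n) w(s) f(s) / (Q;Q)_(n-s)) iterated k times,
   for the weights w(s) = Q^(s^2+s) (r times), Q^(s^2), and Q^(s^2-s) (j times),
   starting from 1/((Q;Q)_n (-q;Q)_n).  By a q-Vandermonde sum these steps act
   diagonally on the Bailey kernels 1/((Q)_(n-m) (Q)_(n+m+1)) (first weight) and
   K_m(n) = 1/((Q)_(n-m) (Q)_(n+m)) (second weight), while the third is
   triangular on the span of K_m and Q^n K_m; its iterates produce the geometric
   sum over 0 <= s <= j.  Expanding the starting sequence in the first family of
   kernels and letting n tend to infinity leaves, for every s, two theta series,
   which the Jacobi triple product evaluates. *)
Require Import Defs.
From mathcomp Require Import all_boot all_order all_algebra.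
From mathcomp Require Import finmap boolp classical_sets functions reals topology normedtype sequences.
From mathcomp Require Import summability complex.
From mathcomp Require Import zify ring.

Set Implicit Arguments.
Unset Strict Implicit.
Unset Printing Implicit Defensive.

Import Order.TTheory GRing.Theory Num.Theory.
Import numFieldNormedType.Exports.

Local Open Scope classical_set_scope.
Local Open Scope ring_scope.

(** * Finite q-series identities *)

Section FinitePochhammer.
Variable F : fieldType.
Implicit Types a q : F.

(** The three kinds of steps are not explicit on one common family: the first weight needs the
    kernels with n+m+1, the other two need K_m. Hence the change of family between them,
    [bkernel10]; it costs a factor 1 - Q^(2m+1), which the coefficients of the starting sequence
    contain. It replaces each kernel by a combination of K_m and K_(m+1). Together with the factor 1
    + q^(2m+1) of [gcoef] this gives four powers of q for each m and each geometric term, and they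
    are the terms with indices m and -1-m of two bilateral theta series, one of them multiplied by
    q. All kernels vanish for m > n, so every expansion is a finite identity over a field;
    convergence enters only at the end, always through domination by a geometric sequence.
    Truncating the outermost sum gives it the same shape as the inner ones. *)

Definition qpochn a q (n : nat) : F := \prod_(m < n) (1 - a * q ^+ m).

Lemma qpochnS a q n : qpochn a q n.+1 = qpochn a q n * (1 - a * q ^+ n).
Proof. by rewrite /qpochn big_ord_recr. Qed.

Definition iqfact q n : F := (qpochn q q n)^-1.

Lemma iqfact0 q : iqfact q 0 = 1.
Proof. by rewrite /iqfact /qpochn big_ord0 invr1. Qed.

Definition nonroot q := forall n, 1 - q ^+ n.+1 != 0.

Lemma iqfactS q n : nonroot q -> iqfact q n = (1 - q ^+ n.+1) * iqfact q n.+1.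
Proof.
by move=> qn1; rewrite /iqfact qpochnS -exprS invfM mulrCA mulfV ?mulr1.
Qed.

End FinitePochhammer.

(** * Action of the summation steps on the Bailey kernels *)

Section BaileyKernels.
Variables (F : fieldType) (Q : F).
Hypothesis Q_nonroot : nonroot Q.
Local Notation ip := (iqfact Q).
Let ipS n : ip n = (1 - Q ^+ n.+1) * ip n.+1 := iqfactS n Q_nonroot.

(* Induction on N, splitting
   1 - Q^N = (1 - Q^(N-t)) + Q^(N-t) (1 - Q^t). *)
Lemma sum_durfee N c :
  \sum_(t < N.+1) Q ^+ (t * t + c * t) * (ip (N - t) * ip t * ip (t + c))
  = ip N * ip (N + c).
Proof.
elim: N c => [|N IHN] c.
  by rewrite big_ord1 /= sub0n !add0n !iqfact0 muln0 expr0 !mul1r.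
apply: (mulfI (Q_nonroot N)); rewrite mulr_sumr.
transitivity (\sum_(t < N.+2) (1 - Q ^+ (N.+1 - t))
      * (Q ^+ (t * t + c * t) * (ip (N.+1 - t) * ip t * ip (t + c)))
  + \sum_(t < N.+2) (1 - Q ^+ t) * (Q ^+ (N.+1 - t + t * t + c * t)
      * (ip (N.+1 - t) * ip t * ip (t + c)))).
  rewrite -big_split; apply: eq_bigr => t _ /=.
  have -> : Q ^+ N.+1 = Q ^+ (N.+1 - t) * Q ^+ t.
    by rewrite -exprD subnK // -ltnS.
  by rewrite -addnA (exprD _ (N.+1 - t)); ring.
rewrite big_ord_recr /= subnn subrr mul0r addr0.
rewrite [X in _ + X]big_ord_recl /= subrr mul0r add0r.
transitivity (ip N * ip (N + c) + Q ^+ (N.+1 + c) * (ip N * ip (N + c.+1))).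
  rewrite -!IHN mulr_sumr; congr (_ + _); apply: eq_bigr => t _.
    have le_tN : (t <= N)%N by rewrite -ltnS.
    by rewrite (subSn le_tN) [in RHS](ipS (N - t)); ring.
  rewrite /bump /= add1n subSS.
  have -> : (N - t + t.+1 * t.+1 + c * t.+1 = N.+1 + c + (t * t + c.+1 * t))%N.
    by have := ltn_ord t; lia.
  by rewrite (exprD _ (N.+1 + c)) -(addSnnS t) (ipS t); ring.
by rewrite addnS (ipS (N + c)) (ipS N) addSn; ring.
Qed.

(** Write 1 = Q^t + (1 - Q^t): the first part is [sum_durfee] at N and c; the second, after shifting
    t by one, is Q^c times [sum_durfee] at N - 1 and c + 1. *)
Lemma sum_durfee_shift N c :
  \sum_(t < N.+1) Q ^+ (t * t.-1 + c * t) * (ip (N - t) * ip t * ip (t + c))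
  = (1 + Q ^+ c - Q ^+ (N + c)) * (ip N * ip (N + c)).
Proof.
transitivity (\sum_(t < N.+1) Q ^+ (t * t + c * t) * (ip (N - t) * ip t * ip (t + c))
  + \sum_(t < N.+1) (1 - Q ^+ t) * (Q ^+ (t * t.-1 + c * t) * (ip (N - t) * ip t * ip (t + c)))).
  rewrite -big_split; apply: eq_bigr => t _ /=.
  have -> : (t * t + c * t = t + (t * t.-1 + c * t))%N by nia.
  by rewrite (exprD _ t); ring.
rewrite sum_durfee [X in _ + X]big_ord_recl /= subrr mul0r add0r.
case: N => [|N].
  by rewrite big_ord0 add0n; ring.
transitivity (ip N.+1 * ip (N.+1 + c) + Q ^+ c * (ip N * ip (N + c.+1))).
  rewrite -(sum_durfee N.+1) -(sum_durfee N) mulr_sumr; congr (_ + _); apply: eq_bigr => t _.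
  rewrite /bump /= add1n subSS.
  have -> : (t.+1 * t + c * t.+1 = c + (t * t + c.+1 * t))%N by lia.
  by rewrite (exprD _ c) -(addSnnS t) (ipS t); ring.
by rewrite (ipS N) addnS addSn -addSn exprD; ring.
Qed.


(** The kernel 1/((Q)_(n-m) (aQ;Q)_(n+m)) of a Bailey pair relative to a = Q^e, up to the constant
    factor (Q)_e. *)
Definition bkernel e m n : F :=
  if (m <= n)%N then ip (n - m) * ip (n + m + e) else 0.

Definition bstep (w : nat -> F) (f : nat -> F) n : F :=
  \sum_(s < n.+1) w s * ip (n - s) * f s.

Lemma eq_bstep w f g n : (forall s, (s <= n)%N -> f s = g s) ->
  bstep w f n = bstep w g n.
Proof. by move=> fg; apply: eq_bigr => s _; rewrite fg // -ltnS. Qed.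

(** A step at n reads only arguments s <= n, so an expansion valid below [M] stays valid below [M].
    This keeps the expansions finite, with coefficients independent of n. *)
Lemma bstep_sum w f (a : nat -> F) (g h : nat -> nat -> F) M :
  (forall n, (n < M)%N -> f n = \sum_(m < M) a m * g m n) ->
  (forall m n, bstep w (g m) n = h m n) ->
  forall n, (n < M)%N -> bstep w f n = \sum_(m < M) a m * h m n.
Proof.
move=> fE gh n ltnM; under eq_bigr do rewrite -gh mulr_sumr.
rewrite exchange_big /=; apply: eq_bigr => s _.
rewrite fE ?mulr_sumr; last by apply: leq_trans ltnM; exact: ltn_ord.
by apply: eq_bigr => m _; rewrite mulrCA.
Qed.

Lemma eq_iter_bstep w f g r n : (forall s, (s <= n)%N -> f s = g s) ->
  iter r (bstep w) f n = iter r (bstep w) g n.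
Proof.
elim: r n => [|r IHr] n fg /=; first exact: fg.
by apply: eq_bstep => s les; apply: IHr => s' les'; exact/fg/(leq_trans les').
Qed.

Lemma iter_bstep_sum w f (a : nat -> F) (g : nat -> nat -> F) M :
  (forall n, (n < M)%N -> f n = \sum_(m < M) a m * g m n) ->
  forall r n, (n < M)%N ->
    iter r (bstep w) f n = \sum_(m < M) a m * iter r (bstep w) (g m) n.
Proof.
move=> fE; elim=> [|r IHr] n ltnM /=; first exact: fE.
exact: (bstep_sum (g := fun m => iter r (bstep w) (g m))
  (h := fun m => iter r.+1 (bstep w) (g m)) IHr (fun _ _ => erefl)).
Qed.

Lemma iter_bstep_eigen w f c r n : (forall n, bstep w f n = c * f n) ->
  iter r (bstep w) f n = c ^+ r * f n.
Proof.
move=> fc; elim: r n => [|r IHr] n /=; first by rewrite mul1r.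
transitivity (c ^+ r * bstep w f n); last by rewrite fc exprSr mulrA.
by rewrite /bstep mulr_sumr; apply: eq_bigr => s _; rewrite IHr mulrCA.
Qed.

Lemma iter_bstepB w f g c r n :
  iter r (bstep w) (fun s => f s - c * g s) n
  = iter r (bstep w) f n - c * iter r (bstep w) g n.
Proof.
elim: r n => [|r IHr] n //=.
rewrite /bstep mulr_sumr -sumrB; apply: eq_bigr => s _; rewrite IHr; ring.
Qed.

Lemma iter_bstepZ w f c r n :
  iter r (bstep w) (fun s => c * f s) n = c * iter r (bstep w) f n.
Proof.
elim: r n => [|r IHr] n //=.
by rewrite /bstep mulr_sumr; apply: eq_bigr => s _; rewrite IHr mulrCA.
Qed.

Lemma bkernel_gt e m n : (n < m)%N -> bkernel e m n = 0.
Proof. by move=> ltnm; rewrite /bkernel leqNgt ltnm. Qed.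

Lemma sum_bkernel e (f : nat -> F) m n : (m <= n)%N ->
  \sum_(s < n.+1) f s * bkernel e m s
  = \sum_(t < (n - m).+1) f (m + t)%N * (ip t * ip (t + (m + m + e))).
Proof.
move=> lemn; rewrite -(big_mkord xpredT (fun s => f s * bkernel e m s)).
rewrite (big_cat_nat (n := m)) ?leqW //= big_nat big1 ?add0r; last first.
  by move=> s /andP[_ ltsm]; rewrite /bkernel leqNgt ltsm mulr0.
rewrite -{1}[m]add0n big_addn subSn // big_mkord; apply: eq_bigr => t _.
rewrite /bkernel leq_addl addnK addnC; congr (_ * (_ * ip _)); lia.
Qed.

Lemma bstep_gt w (f : nat -> F) e m n : (n < m)%N ->
  bstep w (fun s => f s * bkernel e m s) n = 0.
Proof.
move=> ltnm; rewrite /bstep big1 // => s _.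
by rewrite bkernel_gt ?mulr0 // (leq_ltn_trans _ ltnm) // -ltnS.
Qed.

(** With s = m + t the exponent splits into m^2 + e m and t^2 + (2m+e) t, which leaves [sum_durfee]
    at N = n - m and c = 2m + e. This is Bailey's lemma with both parameters sent to infinity. *)
Lemma bstep_bkernel e m n :
  bstep (fun s => Q ^+ (s * s + e * s)) (bkernel e m) n
  = Q ^+ (m * m + e * m) * bkernel e m n.
Proof.
have [ltnm|lemn] := ltnP n m.
  rewrite bkernel_gt // mulr0 -[RHS](bstep_gt (fun s => Q ^+ (s * s + e * s))
    (fun=> 1) e ltnm).
  by apply: eq_bstep => s _; rewrite mul1r.
rewrite /bstep (sum_bkernel e (fun s => Q ^+ (s * s + e * s) * ip (n - s)) lemn).
rewrite /bkernel lemn (_ : n + m + e = n - m + (m + m + e))%N; last by lia.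
rewrite -sum_durfee mulr_sumr; apply: eq_bigr => t _.
rewrite subnDA (_ : (m + t) * (m + t) + e * (m + t)
   = (m * m + e * m) + (t * t + (m + m + e) * t))%N; last by lia.
by rewrite (exprD _ (m * m + e * m)) !mulrA.
Qed.

Definition down_weight s : F := Q ^+ (s * s.-1).

(** The same substitution leads to [sum_durfee_shift]. The resulting factor depends on n, so the
    functions Q^n K_m have to be carried along. *)
Lemma bstep_down m n : bstep down_weight (bkernel 0 m) n
  = (Q ^+ (m * m + m) + Q ^+ (m * m.-1) - Q ^+ (m * m + n)) * bkernel 0 m n.
Proof.
have [ltnm|lemn] := ltnP n m.
  rewrite bkernel_gt // mulr0 -[RHS](bstep_gt down_weight (fun=> 1) 0 ltnm).
  by apply: eq_bstep => s _; rewrite mul1r.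
rewrite /bstep (sum_bkernel 0 (fun s => down_weight s * ip (n - s)) lemn).
rewrite /bkernel lemn (_ : n + m + 0 = n - m + (m + m))%N; last by lia.
have -> : Q ^+ (m * m + m) + Q ^+ (m * m.-1) - Q ^+ (m * m + n)
   = Q ^+ (m * m.-1) * (1 + Q ^+ (m + m) - Q ^+ (n - m + (m + m))).
  rewrite mulrBr mulrDr -!exprD mulr1 [RHS]addrAC [LHS]addrAC.
  by rewrite [LHS]addrC [RHS]addrAC addrA; congr (_ + Q ^+ _ - Q ^+ _); nia.
rewrite -mulrA -sum_durfee_shift mulr_sumr; apply: eq_bigr => t _.
rewrite subnDA addn0 /down_weight (_ : (m + t) * (m + t).-1
   = (m * m.-1) + (t * t.-1 + (m + m) * t))%N; last by nia.
by rewrite (exprD _ (m * m.-1)) !mulrA.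
Qed.

(** The extra Q^s turns the weight Q^(s^2-s) into Q^(s^2), for which K_m is an eigenvector. *)
Lemma bstep_down_pow m n :
  bstep down_weight (fun s => Q ^+ s * bkernel 0 m s) n
  = Q ^+ (m * m) * bkernel 0 m n.
Proof.
rewrite -[(m * m)%N]addn0 -[0%N in RHS](mul0n m) -bstep_bkernel.
apply: eq_bigr => s _; rewrite mulrA; congr (_ * _).
rewrite mulrAC /down_weight -exprD; congr (Q ^+ _ * _); nia.
Qed.

(** The quotient (x^j - y^j)/(x - y) without division, since x = y does occur below, at m = 0. *)
Definition geom (x y : F) j : F := \sum_(i < j) x ^+ (j.-1 - i) * y ^+ i.

Lemma geomSl x y j : geom x y j.+1 = x * geom x y j + y ^+ j.
Proof.
rewrite /geom big_ord_recr /= subnn mul1r mulr_sumr; congr (_ + _).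
apply: eq_bigr => i _; rewrite mulrA -exprS; congr (x ^+ _ * _).
by have := ltn_ord i; lia.
Qed.

Lemma geomSS x y j :
  geom x y j.+2 = (x + y) * geom x y j.+1 - x * y * geom x y j.
Proof. by rewrite geomSl [in LHS]exprS (geomSl x y j); ring. Qed.

(** Put x = Q^(m^2-m) and y = Q^(m^2+m). In terms of K_m and Q^n K_m the step is a 2 by 2 matrix
    with trace x + y and determinant Q^(2m^2) = x y, so its powers follow the recurrence
    [geomSS]. *)
Lemma iter_bstep_down j m n : let A := geom (Q ^+ (m * m.-1)) (Q ^+ (m * m + m)) in
  iter j (bstep down_weight) (bkernel 0 m) n
  = (A j.+1 - Q ^+ (m * m + n) * A j) * bkernel 0 m n.
Proof.
move=> A; elim: j n => [|j IHj] n /=.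
  by rewrite /A {2}/geom big_ord0 geomSl /geom big_ord0; ring.
transitivity (bstep down_weight (fun s => A j.+1 * bkernel 0 m s
    - Q ^+ (m * m) * A j * (Q ^+ s * bkernel 0 m s)) n).
  by apply: eq_bstep => s _; rewrite IHj exprD; ring.
transitivity (A j.+1 * bstep down_weight (bkernel 0 m) n
  - Q ^+ (m * m) * A j
    * bstep down_weight (fun s => Q ^+ s * bkernel 0 m s) n).
  rewrite /bstep !mulr_sumr -sumrB; apply: eq_bigr => s _; ring.
rewrite bstep_down bstep_down_pow [A j.+2]geomSS -/(A j.+1) -/(A j).
have e : Q ^+ (m * m.-1) * Q ^+ (m * m + m) = Q ^+ (m * m) * Q ^+ (m * m).
  by rewrite -!exprD; congr (Q ^+ _); nia.
by rewrite e; ring.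
Qed.

(** For m < n this is 1 - Q^(2m+1) = (1 - Q^(n+m+1)) - Q^(2m+1) (1 - Q^(n-m)). It passes from
    kernels relative to a = Q to kernels relative to a = 1. *)
Lemma bkernel10 m n : (1 - Q ^+ (m + m).+1) * bkernel 1 m n
  = bkernel 0 m n - Q ^+ (m + m).+1 * bkernel 0 m.+1 n.
Proof.
rewrite /bkernel; case: (ltngtP m n) => [ltmn|ltnm|->].
- have [d ->] : exists d, n = (m.+1 + d)%N by exists (n - m.+1)%N; lia.
  have -> : (m.+1 + d - m = d.+1)%N by lia.
  have -> : (m.+1 + d - m.+1 = d)%N by lia.
  rewrite addn0 addn1 addn0 addnS (ipS (m.+1 + d + m)) (ipS d).
  have -> : ((m.+1 + d + m).+1 = (m + m).+1 + d.+1)%N by lia.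
  by rewrite (exprD _ _ d.+1); ring.
- by rewrite !mulr0 subrr.
- by rewrite addn0 addn1 subnn (ipS (n + n)); ring.
Qed.

End BaileyKernels.

(** * Expansion of the starting sequence and of the nested sum *)

Section InitialPair.
Variables (F : fieldType) (q : F).
Hypothesis Q_nonroot : nonroot (q ^+ 2).
Local Notation Q := (q ^+ 2).
Local Notation ip := (iqfact Q).
Let ipS n : ip n = (1 - Q ^+ n.+1) * ip n.+1 := iqfactS n Q_nonroot.

(* 4 'C(m, 2) + m is 2 m^2 - m, without truncated subtraction. *)
Definition gcoef m : F :=
  (- 1) ^+ m * q ^+ (4 * 'C(m, 2) + m) * (1 + q ^+ (m + m).+1).

Let t n m : F := gcoef m * (1 - Q ^+ (m + m).+1) * ip (n - m) * ip (n + m).+1.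

(* A q-Zeilberger certificate: with Q-factorial ratios inserted, the left-hand
   summand is (1 - Q^(n+1)) (1 + q^(2n+1)) t (n+1) m - t n m, and its sum over
   all m vanishes since the right-hand side does at M = n+1. *)
Let certificate n M : (M <= n.+1)%N ->
  \sum_(m < M.+1) ((1 - Q ^+ n.+1) * (1 + q ^+ (n + n).+1)
     - (1 - Q ^+ (n.+1 - m)) * (1 - Q ^+ (n + m).+2)) * t n.+1 m
  = (- 1) ^+ M * q ^+ (4 * 'C(M, 2) + 3 * M + (n + n).+1)
    * (1 + q ^+ (M + M).+3) * (1 - Q ^+ M.+1) * (1 + q ^+ (M + M).+1)
    * ((1 - Q ^+ (n.+1 - M)) * ip (n.+1 - M) * ip (n + M).+2).
Proof.
elim: M => [|M IHM] leMn.
  rewrite big_ord1 /t /gcoef /= bin_small // !muln0 !addn0 !subn0 !mul1r !expr1.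
  rewrite add0n -!exprM.
  have -> : q ^+ (2 * n.+2) = q ^+ (n + n).+1 * q ^+ 3 by rewrite -exprD; congr (_ ^+ _); lia.
  by ring.
rewrite big_ord_recr /= IHM 1?ltnW // /t /gcoef subSS.
have [d nE] : exists d, n = (M + d)%N by exists (n - M)%N; lia.
have -> : (n.+1 - M = d.+1)%N by lia.
have -> : (n - M = d)%N by lia.
have -> : (n.+1 + M.+1 = (n + M).+2)%N by lia.
have -> : ((n + M.+1).+2 = (n + M).+3)%N by lia.
rewrite -ipS (ipS (n + M).+2) binS bin1 [(-1) ^+ M.+1]exprS.
rewrite nE -!exprM.
set u := (-1) ^+ M; set i1 := ip d; set i2 := ip _.
(* Every power of q becomes a monomial in c, x = q^M, y = q^d and q, so that [ring] can treat M and
   d as generic. *)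
pose c := q ^+ (4 * 'C(M, 2) + M).
pose x := q ^+ M; pose y := q ^+ d.
have pwE e a b k : (e = M * a + d * b + k)%N -> q ^+ e = x ^+ a * y ^+ b * q ^+ k.
  by move=> ->; rewrite -!exprM -!exprD.
have pwcE e a b k : (e = 4 * 'C(M, 2) + M + (M * a + d * b + k))%N ->
    q ^+ e = c * (x ^+ a * y ^+ b * q ^+ k).
  by move=> ->; rewrite -!exprM -!exprD.
rewrite (pwcE (4 * 'C(M, 2) + 3 * M + (M + d + (M + d)).+1)%N 4 2 1)%N; last by lia.
rewrite (pwcE (4 * ('C(M, 2) + M) + 3 * M.+1 + (M + d + (M + d)).+1)%N 8 2 4)%N; last by lia.
rewrite (pwcE (4 * ('C(M, 2) + M) + M.+1)%N 4 0 1)%N; last by lia.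
rewrite (pwE (M + M).+3 2 0 3)%N; last by lia.
rewrite (pwE (M + M).+1 2 0 1)%N; last by lia.
rewrite (pwE (M.+1 + M.+1).+3 2 0 5)%N; last by lia.
rewrite (pwE (M.+1 + M.+1).+1 2 0 3)%N; last by lia.
rewrite (pwE (2 * M.+1) 2 0 2)%N; last by lia.
rewrite (pwE (2 * M.+2) 2 0 4)%N; last by lia.
rewrite (pwE (2 * (M.+1 + M.+1).+1) 4 0 6)%N; last by lia.
rewrite (pwE (2 * (M + d + M).+3) 4 2 6)%N; last by lia.
rewrite (pwE (2 * (M + d).+1) 2 2 2)%N; last by lia.
rewrite (pwE (M + d + (M + d)).+1 2 2 1)%N; last by lia.
rewrite (pwE (2 * d) 0 2 0)%N; last by lia.
by ring.
Qed.

Definition beta0 n : F := ip n / qpochn (- q) Q n.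

Let oddpow_neq n : 1 + q ^+ (n + n).+1 != 0.
Proof.
(* 1 + q^(2n+1) divides 1 - Q^(2n+1). *)
apply: contraNneq (Q_nonroot (n + n)) => e.
by rewrite exprAC -[1 - _]opprB subr_sqr_1 (addrC _ 1) e mulr0 oppr0.
Qed.

(** Both sides satisfy (1 - Q^(n+1)) (1 + q^(2n+1)) f(n+1) = f(n) and agree at n = 0. For the
    left-hand side the recurrence is the definition; for the right-hand side it is [certificate] at
    M = n + 1. *)
Lemma initial_pair M n : (n < M)%N ->
  beta0 n = \sum_(m < M) gcoef m * (1 - Q ^+ (m + m).+1) / (1 + q)
                        * bkernel Q 1 m n.
Proof.
move=> ltnM; have q1 : 1 + q != 0 by have := oddpow_neq 0.
transitivity ((1 + q)^-1 * \sum_(m < n.+1) t n m); last first.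
  rewrite (big_ord_widen M (t n)) // big_mkcond mulr_sumr.
  apply: eq_bigr => m _; rewrite /bkernel addn1 ltnS /t.
  by case: (m <= n)%N => /=; rewrite ?mulr0 //; ring.
apply: (mulfI q1); rewrite [RHS]mulVKf // {ltnM M}.
elim: n => [|n IHn].
  rewrite big_ord1 /beta0 /qpochn big_ord0 invr1 mulr1 /t /gcoef bin_small //=.
  by rewrite /= !addn0 muln0 mul1r [in LHS]ipS iqfact0 !expr0 !expr1; ring.
have certF := certificate (leqnn n.+1); move: certF.
rewrite subnn expr0 subrr !(mulr0, mul0r) => certF.
have tE m : (m <= n)%N ->
    t n m = (1 - Q ^+ (n.+1 - m)) * (1 - Q ^+ (n + m).+2) * t n.+1 m.
  by move=> lemn; rewrite /t subSn // (ipS (n - m)) (ipS (n + m).+1) addSn; ring.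
(* The sum of [t n] may be extended to m = n + 1, because the factor 1 - Q^(n+1-m) in [tE] vanishes
   there. *)
have step : (1 - Q ^+ n.+1) * (1 + q ^+ (n + n).+1) * \sum_(m < n.+2) t n.+1 m
     = \sum_(m < n.+1) t n m.
  apply/eqP; rewrite -subr_eq0 -[X in _ == X]certF.
  rewrite mulr_sumr [in X in _ - X](eq_bigr (fun m : 'I_n.+1 =>
    (1 - Q ^+ (n.+1 - m)) * (1 - Q ^+ (n + m).+2) * t n.+1 m)).
    rewrite [X in _ == X](eq_bigr (fun m : 'I_n.+2 =>
      (1 - Q ^+ n.+1) * (1 + q ^+ (n + n).+1) * t n.+1 m
      - (1 - Q ^+ (n.+1 - m)) * (1 - Q ^+ (n + m).+2) * t n.+1 m)).
      rewrite sumrB [in X in _ - _ == _ - X]big_ord_recr /= subnn expr0 subrr.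
      by rewrite !mul0r addr0.
    by move=> m _; rewrite mulrBl.
  by move=> m _; rewrite tE // -ltnS.
apply: (mulfI (mulf_neq0 (Q_nonroot n) (oddpow_neq n))).
have pS : qpochn (- q) Q n.+1 = qpochn (- q) Q n * (1 + q ^+ (n + n).+1).
  by rewrite qpochnS mulNr opprK -exprM mul2n -addnn -exprS.
rewrite step -IHn /beta0 pS (ipS n) invfM.
by move: (qpochn _ _ n)^-1 => p; field; rewrite oddpow_neq.
Qed.

Definition up_weight e s : F := Q ^+ (s * s + e * s).

Definition nested_sum j d r : nat -> F :=
  iter j (bstep Q (down_weight Q))
    (iter d (bstep Q (up_weight 0)) (iter r (bstep Q (up_weight 1)) beta0)).

Definition geomQ m j : F := geom (Q ^+ (m * m.-1)) (Q ^+ (m * m + m)) j.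

(** The image of K_m under d steps of the second weight followed by j of the third. *)
Definition theta_block j d m n : F :=
  Q ^+ (m * m) ^+ d * ((geomQ m j.+1 - Q ^+ (m * m + n) * geomQ m j)
                       * bkernel Q 0 m n).

(** The r innermost steps only multiply the kernels of the first family by eigenvalues; [bkernel10]
    then absorbs the factor 1 - Q^(2m+1), and the other steps act on K_m and K_(m+1). *)
Lemma nested_sumE j d r M n : (n < M)%N ->
  nested_sum j d r n = \sum_(m < M)
    gcoef m / (1 + q) * Q ^+ (m * m + m) ^+ r
      * (theta_block j d m n - Q ^+ (m + m).+1 * theta_block j d m.+1 n).
Proof.
move=> ltnM.
have upE e m n' : bstep Q (up_weight e) (bkernel Q e m) n'
    = up_weight e m * bkernel Q e m n' by exact: bstep_bkernel.
pose a m : F := gcoef m / (1 + q) * Q ^+ (m * m + m) ^+ r.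
pose g m s : F := bkernel Q 0 m s - Q ^+ (m + m).+1 * bkernel Q 0 m.+1 s.
have stage1 s : (s < M)%N -> iter r (bstep Q (up_weight 1)) beta0 s
    = \sum_(m < M) a m * g m s.
  move=> ltsM; rewrite (iter_bstep_sum _ _ (a := fun m => gcoef m * (1 - Q ^+ (m + m).+1) / (1 + q))
    (g := bkernel Q 1) (@initial_pair M)) //.
  apply: eq_bigr => m _; rewrite (iter_bstep_eigen _ _ (upE 1%N m)).
  by rewrite /g -bkernel10 // /a /up_weight mul1n; ring.
have stage2 := iter_bstep_sum Q (up_weight 0) (a := a) (g := g) stage1 d.
rewrite /nested_sum (iter_bstep_sum _ _ (a := a)
  (g := fun m => iter d (bstep Q (up_weight 0)) (g m)) stage2) //; apply: eq_bigr => m _.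
rewrite -/(a m); congr (_ * _).
transitivity (iter j (bstep Q (down_weight Q)) (fun s =>
     up_weight 0 m ^+ d * bkernel Q 0 m s
     - Q ^+ (m + m).+1 * (up_weight 0 m.+1 ^+ d * bkernel Q 0 m.+1 s)) n).
  by apply: eq_iter_bstep => s _; rewrite /g iter_bstepB !(iter_bstep_eigen _ _ (upE 0%N _)).
rewrite iter_bstepB !iter_bstepZ !iter_bstep_down //.
by rewrite /theta_block /up_weight /geomQ !mul0n !addn0.
Qed.

End InitialPair.

(** * Finite form of the Jacobi triple product *)

Section FiniteTripleProduct.
Variables (F : fieldType) (P : F).
Hypothesis P_nonroot : nonroot P.
Local Notation ip := (iqfact P).
Let ipS n : ip n = (1 - P ^+ n.+1) * ip n.+1 := iqfactS n P_nonroot.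

Let qpochn_ip n : qpochn P P n * ip n = 1.
Proof.
by rewrite mulfV //; apply/prodf_neq0 => i _; rewrite -exprS P_nonroot.
Qed.

Definition gaussbin n k : F :=
  if (k <= n)%N then qpochn P P n * ip k * ip (n - k) else 0.

Lemma gaussbin0 n : gaussbin n 0 = 1.
Proof. by rewrite /gaussbin subn0 iqfact0 mulr1 qpochn_ip. Qed.

Lemma gaussbin_gt n k : (n < k)%N -> gaussbin n k = 0.
Proof. by move=> ltnk; rewrite /gaussbin leqNgt ltnk. Qed.

Lemma gaussbinS n k :
  (k <= n)%N -> gaussbin n.+1 k.+1 = gaussbin n k.+1 + P ^+ (n - k) * gaussbin n k.
Proof.
move=> lekn; rewrite /gaussbin lekn ltnS lekn subSS qpochnS -exprS (ipS k).
case: ltngtP lekn => // [ltkn|<-] _; last first.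
  by rewrite subnn expr0; ring.
have [d ->] : exists d, n = (k.+1 + d)%N by exists (n - k.+1)%N; lia.
have -> : (k.+1 + d - k = d.+1)%N by lia.
have -> : (k.+1 + d - k.+1 = d)%N by lia.
by rewrite (ipS d) -addnS exprD; ring.
Qed.

(* The coefficient with index m = k - b of the triple product in X and Y = P/X:
   keeping Y as a separate variable avoids negative powers of X. *)
Definition jcoef (X Y : F) b k : F :=
  if (b <= k)%N then (- X) ^+ (k - b) * P ^+ 'C(k - b, 2)
  else (- Y) ^+ (b - k) * P ^+ 'C(b - k, 2).

Let jsum X Y a b := \sum_(k < (a + b).+1) jcoef X Y b k * gaussbin (a + b) k.

(** Consecutive coefficients have ratio - X P^(k-b), also across k = b because X Y = P. The power
    P^(a+b-k) from the q-Pascal rule makes it independent of k, so raising a by one multiplies the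
    whole sum by 1 - X P^a. *)
Lemma jcoefS X Y a b k : X * Y = P -> (k <= a + b)%N ->
  jcoef X Y b k.+1 * P ^+ (a + b - k) = - (X * P ^+ a) * jcoef X Y b k.
Proof.
move=> XY lek; rewrite /jcoef; case: (leqP b k) => [lebk|ltkb].
  rewrite leqW // subSn // binS bin1 exprS.
  have -> : P ^+ a = P ^+ (k - b) * P ^+ (a + b - k).
    by rewrite -exprD; congr (P ^+ _); lia.
  by rewrite exprD; ring.
rewrite leq_eqVlt ltnNge ltkb orbF.
have [l bE] : exists l, b = (k + l.+1)%N by exists (b - k.+1)%N; lia.
have -> : (b - k = l.+1)%N by lia.
have -> : (a + b - k = a + l.+1)%N by lia.
rewrite bE !addnS; case: eqP => [e|_].
  have -> : l = 0%N by lia.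
  rewrite !addn0 subnn bin_small // !expr0 !expr1 exprS -{1}XY; ring.
have -> : ((k + l).+1 - k.+1 = l)%N by lia.
rewrite binS bin1 [(- Y) ^+ l.+1]exprS; have -> : P ^+ (a + l).+1 = X * Y * P ^+ a * P ^+ l.
  by rewrite XY exprS exprD mulrA.
by rewrite exprD; ring.
Qed.

Let jsumS X Y a b : X * Y = P ->
  jsum X Y a.+1 b = (1 - X * P ^+ a) * jsum X Y a b.
Proof.
move=> XY; rewrite /jsum addSn big_ord_recl /= gaussbin0.
transitivity (\sum_(k < (a + b).+2) jcoef X Y b k * gaussbin (a + b) k
  + \sum_(k < (a + b).+1) jcoef X Y b k.+1 * P ^+ (a + b - k) * gaussbin (a + b) k).
  rewrite [in RHS]big_ord_recl gaussbin0 -addrA -big_split; congr (_ + _).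
  apply: eq_bigr => k _ /=; rewrite /bump !add1n gaussbinS; last by rewrite -ltnS.
  by ring.
rewrite big_ord_recr /= gaussbin_gt // mulr0 addr0 mulrBl mul1r; congr (_ + _).
rewrite -mulNr mulr_sumr; apply: eq_bigr => k _.
by rewrite jcoefS // ?mulrA // -ltnS.
Qed.

Let jsum_sym X Y a b : jsum X Y a b = jsum Y X b a.
Proof.
rewrite /jsum (addnC b a) (reindex_inj rev_ord_inj); apply: eq_bigr => k _ /=.
have lek : (k <= a + b)%N by rewrite -ltnS.
rewrite subSS; congr (_ * _); last first.
  by rewrite /gaussbin leq_subr lek subKn // mulrAC.
rewrite /jcoef; case: (leqP b (a + b - k)) => h; case: (leqP a k) => h'; try lia.
- have -> : k = a :> nat by lia.
  by rewrite addKn !subnn.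
- by have -> : (a + b - k - b = a - k)%N by lia.
- by have -> : (b - (a + b - k) = k - a)%N by lia.
Qed.

(** Induction on a by [jsumS]; reversing the sum exchanges X with Y and a with b, so the same lemma
    serves for the induction on b. *)
Lemma finite_triple_product X Y a b : X * Y = P ->
  \sum_(k < (a + b).+1) jcoef X Y b k * gaussbin (a + b) k
  = qpochn X P a * qpochn Y P b.
Proof.
move=> XY; rewrite -/(jsum X Y a b).
elim: a => [|a IHa]; last by rewrite jsumS // IHa qpochnS; ring.
rewrite [qpochn X P 0]/qpochn big_ord0 mul1r jsum_sym.
elim: b => [|b IHb]; last by rewrite jsumS 1?mulrC // IHb qpochnS; ring.
by rewrite /jsum big_ord1 gaussbin0 /jcoef leqnn subnn bin_small // !mulr1 /qpochn big_ord0.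
Qed.

(* The terms with indices m and - 1 - m together. *)
Definition jpair (X Y : F) m : F :=
  (-1) ^+ m * P ^+ 'C(m, 2) * (X ^+ m - Y ^+ m.+1 * P ^+ m).

(** With a = n and b = n + 1 the indices m and -1-m sit at k = n+1+m and k = n-m, where the Gaussian
    binomials agree; divided by (P)_(2n+1) they are the kernel with e = 1. *)
Lemma finite_triple_product_pairs X Y n : X * Y = P ->
  \sum_(m < n.+1) jpair X Y m * bkernel P 1 m n
  = qpochn X P n * qpochn Y P n.+1 * ip (n + n.+1).
Proof.
move=> XY; rewrite -(finite_triple_product _ _ XY).
transitivity (\sum_(k < (n.+1 + n.+1)) jcoef X Y n.+1 k * gaussbin (n + n.+1) k
    * ip (n + n.+1)); last by rewrite mulr_suml.
rewrite big_split_ord /= [X in _ = X + _](reindex_inj rev_ord_inj) -big_split /=.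
apply: eq_bigr => m _; have lemn : (m <= n)%N by rewrite -ltnS.
rewrite /bkernel lemn /gaussbin /jcoef subSS leqNgt ltnS leq_subr /= leq_addr.
have -> : (n - m <= n + n.+1)%N by lia.
have -> : (n.+1 + m <= n + n.+1)%N by lia.
have -> : (n.+1 + m - n.+1 = m)%N by lia.
have -> : (n.+1 - (n - m) = m.+1)%N by lia.
have -> : (n + n.+1 - (n - m) = (n + m).+1)%N by lia.
have -> : (n + n.+1 - (n.+1 + m) = n - m)%N by lia.
rewrite addn1 addSn; have := qpochn_ip (n + n.+1); set p := qpochn _ _ _.
set i := ip (n + n.+1) => pi1; set i1 := ip _; set i2 := ip _.
transitivity (jpair X Y m * (p * i) * i1 * i2); first by rewrite pi1; ring.
rewrite /jpair binS bin1 exprD -!(mulN1r X) -!(mulN1r Y) !exprMn.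
by rewrite [(-1) ^+ m.+1]exprS; ring.
Qed.

End FiniteTripleProduct.

(** * Matching the exponents with two theta series *)

Section ThetaTerms.
Variables (F : fieldType) (q : F).
Local Notation Q := (q ^+ 2).

Lemma sqr_bin2 m : (m * m = 2 * 'C(m, 2) + m)%N.
Proof. by elim: m => // m IHm; rewrite binS bin1; lia. Qed.

Lemma mul_pred_bin2 m : (m * m.-1 = 2 * 'C(m, 2))%N.
Proof. by have := sqr_bin2 m; case: m => //= m; lia. Qed.

(* Here a is the summation index s of the theorem and b is j - s, so that
   k = a + b + d + r. *)
Definition theta_pair d r a b m : F :=
  jpair (q ^+ (4 * (a + b + d + r) + 4)) (q ^+ (2 * d + 4 * r + 1 + 4 * a))
    (q ^+ (2 * d + 3 + 4 * b)) m
  + q * jpair (q ^+ (4 * (a + b + d + r) + 4)) (q ^+ (2 * d + 4 * r + 3 + 4 * a))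
    (q ^+ (2 * d + 1 + 4 * b)) m.

(** Expanding 1 + q^(2m+1) gives two positive and two negative powers. The first positive power
    pairs with the last negative one in the first [jpair], the two middle ones pair in the
    second. *)
Lemma theta_pairE d r a b m :
  gcoef q m * Q ^+ (m * m + m) ^+ r
  * (Q ^+ (m * m) ^+ d * (Q ^+ (m * m.-1) ^+ b * Q ^+ (m * m + m) ^+ a)
     - Q ^+ (m + m).+1 * (Q ^+ (m.+1 * m.+1) ^+ d
         * (Q ^+ (m.+1 * m) ^+ a * Q ^+ (m.+1 * m.+1 + m.+1) ^+ b)))
  = theta_pair d r a b m.
Proof.
have mS : (m.+1 * m = 2 * ('C(m, 2) + m))%N.
  by rewrite (mul_pred_bin2 m.+1) binS bin1.
rewrite /theta_pair /jpair /gcoef mul_pred_bin2 mS !sqr_bin2 binS bin1.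
set c := 'C(m, 2); set p := (4 * (a + b + d + r) + 4)%N.
pose A := (2 * ((2 * c + m + m) * r + (2 * c + m) * d + 2 * c * b
                + (2 * c + m + m) * a))%N.
pose B := (2 * ((2 * c + m + m) * r + (m + m).+1 + (2 * (c + m) + m.+1) * d
                + 2 * (c + m) * a + (2 * (c + m) + m.+1 + m.+1) * b))%N.
transitivity ((-1) ^+ m * (q ^+ (4 * c + m + A) + q ^+ (4 * c + m + (m + m).+1 + A)
   - q ^+ (4 * c + m + B) - q ^+ (4 * c + m + (m + m).+1 + B))).
  have HA : Q ^+ (2 * c + m + m) ^+ r * (Q ^+ (2 * c + m) ^+ d
      * (Q ^+ (2 * c) ^+ b * Q ^+ (2 * c + m + m) ^+ a)) = q ^+ A.
    by rewrite -!exprM -!exprD /A; congr (q ^+ _); lia.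
  have HB : Q ^+ (2 * c + m + m) ^+ r * (Q ^+ (m + m).+1
      * (Q ^+ (2 * (c + m) + m.+1) ^+ d * (Q ^+ (2 * (c + m)) ^+ a
         * Q ^+ (2 * (c + m) + m.+1 + m.+1) ^+ b))) = q ^+ B.
    by rewrite -!exprM -!exprD /B; congr (q ^+ _); lia.
  by rewrite -mulrA mulrBr HA HB !(exprD _ _ A) !(exprD _ _ B) !(exprD _ _ (m + m).+1); ring.
have -> : (4 * c + m + A = p * c + (2 * d + 4 * r + 1 + 4 * a) * m)%N by rewrite /A /p; lia.
have -> : (4 * c + m + (m + m).+1 + A = 1 + p * c + (2 * d + 4 * r + 3 + 4 * a) * m)%N.
  by rewrite /A /p; lia.
have -> : (4 * c + m + B = 1 + p * c + (2 * d + 1 + 4 * b) * m.+1 + p * m)%N.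
  by rewrite /B /p; lia.
have -> : (4 * c + m + (m + m).+1 + B = p * c + (2 * d + 3 + 4 * b) * m.+1 + p * m)%N.
  by rewrite /B /p; lia.
rewrite -!exprM !(exprD q _ (p * m)).
rewrite !(exprD q _ (_ * m)) !(exprD q _ (_ * m.+1)) !(exprD q 1 (p * c)) expr1.
by ring.
Qed.

End ThetaTerms.

(** * Limits *)

Section Limits.
Variable K : numFieldType.
Implicit Types (u v : nat -> K) (x y z l c : K).

Lemma cvgn_distP u l : u @ \oo --> l <->
  forall e, 0 < e -> exists N, forall n, (N <= n)%N -> `|l - u n| < e.
Proof.
split=> [/cvgrPdist_lt ul e /ul [N _ NP]|ul]; first by exists N => n /NP.
by apply/cvgrPdist_lt => e /ul [N NP]; exists N => // n /= /NP.
Qed.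

Lemma cvgn_lim u l : u @ \oo --> l -> lim (u @ \oo) = l.
Proof. by move/cvg_lim; apply. Qed.

Lemma cvgn_ext u v l : (forall n, u n = v n) -> u @ \oo --> l -> v @ \oo --> l.
Proof. by move=> /funext ->. Qed.

Lemma cvgn_uniq u l l' : u @ \oo --> l -> u @ \oo --> l' -> l = l'.
Proof. by move=> /cvgn_lim <- /cvgn_lim <-. Qed.

Lemma cvgn_bounded u : cvgn u -> exists2 B, 0 <= B & forall n, `|u n| <= B.
Proof.
move=> /cvgn_distP /(_ 1 ltr01) [N NP].
exists (\sum_(i < N) `|u i| + (`|lim (u @ \oo)| + 1)) => [|n].
  by rewrite addr_ge0 ?sumr_ge0 // addr_ge0.
have [ltnN|leNn] := ltnP n N.
  rewrite (bigD1 (Ordinal ltnN)) //= -addrA lerDl addr_ge0 ?sumr_ge0 //.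
  by rewrite addr_ge0.
rewrite ler_wpDl ?sumr_ge0 //.
rewrite -[u n](subKr (lim (u @ \oo))); apply: le_trans (ler_normB _ _) _.
by rewrite lerD2l ltW // NP.
Qed.

Lemma cvgn_sum M (f : nat -> nat -> K) (l : nat -> K) :
  (forall i, (i < M)%N -> f i @ \oo --> l i) ->
  (fun n => \sum_(i < M) f i n) @ \oo --> \sum_(i < M) l i.
Proof.
elim: M => [|M IHM] fl.
  rewrite big_ord0; under eq_fun do rewrite big_ord0; exact: cvg_cst.
rewrite big_ord_recr; under eq_fun do rewrite big_ord_recr.
by apply: cvgD; [apply: IHM => i lti; exact/fl/ltnW | exact: fl].
Qed.

(* The norm of R[i] takes values in R[i], so that its completeness is not
   available from the library; the following weak form suffices. *)
Definition geometrically_complete := forall u c y, 0 <= y -> y < 1 ->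
  (forall n, `|u n.+1 - u n| <= c * y ^+ n) -> cvgn u.

Hypothesis K_complete : geometrically_complete.

(** A [numFieldType] need not be archimedean, so this rests on [geometrically_complete]: the powers
    have a limit l, shifting gives l = x l, and x is not 1. *)
Lemma cvgn_expr x : `|x| < 1 -> (fun n => x ^+ n) @ \oo --> (0 : K).
Proof.
move=> x1; have [l xl] : exists l, (fun n => x ^+ n) @ \oo --> l.
  exists (lim ((fun n => x ^+ n) @ \oo)).
  apply: (K_complete (c := `|x - 1|) (normr_ge0 x) x1) => n.
  by rewrite exprS -{2}[x ^+ n]mul1r -mulrBl normrM normrX.
have xl' : (fun n => x ^+ n.+1) @ \oo --> x * l.
  under eq_fun do rewrite exprS.
  exact: (cvgM (cvg_cst x) xl).
have /eqP : l = x * l.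
  by apply: (cvgn_uniq _ xl'); move: xl; rewrite -cvg_shiftS.
rewrite -subr_eq0 -{1}[l]mul1r -mulrBl mulf_eq0 => /orP[|/eqP <- //].
by rewrite subr_eq0 => /eqP x1'; rewrite -x1' normr1 ltxx in x1.
Qed.

Lemma expr_small c y e : 0 <= c -> 0 <= y -> y < 1 -> 0 < e ->
  exists N, forall n, (N <= n)%N -> c * y ^+ n < e.
Proof.
move=> c0 y0 y1 e0.
have : (fun n => c * y ^+ n) @ \oo --> c * 0.
  by apply: cvgM; [exact: cvg_cst | apply: cvgn_expr; rewrite ger0_norm].
rewrite mulr0 => /cvgn_distP /(_ e e0) [N NP]; exists N => n /NP.
by rewrite sub0r normrN ger0_norm // mulr_ge0 ?exprn_ge0.
Qed.

Lemma geometric_tail y m n : 0 <= y -> y < 1 ->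
  \sum_(m <= i < n) y ^+ i <= y ^+ m / (1 - y).
Proof.
move=> y0 y1; have y1' : 0 < 1 - y by rewrite subr_gt0.
rewrite ler_pdivlMr //; have [lenm|ltmn] := leqP n m.
  by rewrite big_geq // mul0r exprn_ge0.
rewrite mulr_suml (eq_bigr (fun i => - (y ^+ i.+1 - y ^+ i))); last by move=> i _; rewrite exprS; ring.
by rewrite sumrN telescope_sumr ?(ltnW ltmn) // opprB lerBlDr lerDl exprn_ge0.
Qed.

(* The factors being eventually at most z = 2 / (1 + y), the partial products grow
   at most like z^n, and z y < 1. *)
Lemma cvgn_prod (f : nat -> K) c y : 0 <= c -> 0 <= y -> y < 1 ->
  (forall n, `|f n| <= c * y ^+ n) -> cvgn (fun n => \prod_(m < n) (1 + f m)).
Proof.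
move=> c0 y0 y1 fc; pose z : K := 2 / (1 + y); pose p n := \prod_(m < n) (1 + f m).
have y2 : 0 < 1 + y by rewrite ltr_wpDr.
have z1 : 1 < z by rewrite /z ltr_pdivlMr // mul1r [ltRHS]mulr2n ltrD2l.
have z0 : 0 <= z by rewrite (le_trans _ (ltW z1)).
have zy1 : z * y < 1.
  by rewrite /z mulrAC ltr_pdivrMr // mul1r [2 * y]mulr_natl mulr2n ltrD2r.
have z1' : 0 < z - 1 by rewrite subr_gt0.
have [N NP] := expr_small c0 y0 y1 z1'.
have c1 : 1 <= 1 + c by rewrite lerDl.
have fle n : `|1 + f n| <= if (n < N)%N then 1 + c else z.
  apply: (le_trans (ler_normD _ _)); rewrite normr1.
  case: ltnP => leNn.
    rewrite lerD2l (le_trans (fc n)) // ler_piMr // exprn_ile1 // ltW //.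
  by rewrite -lerBrDl (le_trans (fc n)) // ltW // NP.
have ple n : `|p n| <= (1 + c) ^+ N * z ^+ n.
  have [B B1 BP] : exists2 B, 1 <= B & B = (1 + c) ^+ N.
    by exists ((1 + c) ^+ N) => //; rewrite exprn_ege1.
  suff : `|p n| <= (1 + c) ^+ (minn n N) * z ^+ n.
    move/le_trans; apply; rewrite ler_wpM2r ?exprn_ge0 //.
    by rewrite ler_weXn2l // geq_minr.
  elim: n => [|n IHn]; first by rewrite /p big_ord0 normr1 min0n mulr1.
  rewrite /p big_ord_recr /= normrM; apply: le_trans (ler_pM _ _ IHn (fle n)) _ => //.
  case: ltnP => ltnN.
    rewrite !(minn_idPl _) // ?(ltnW ltnN) // !exprSr mulrAC mulrA.
    by rewrite ler_peMr ?(ltW z1) // !mulr_ge0 ?exprn_ge0 // (le_trans _ c1).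
  by rewrite !(minn_idPr _) ?(leqW ltnN) // exprSr mulrA.
apply: (K_complete (c := (1 + c) ^+ N * c) (y := z * y)) => // [|n].
  by rewrite mulr_ge0.
have -> : p n.+1 - p n = p n * f n by rewrite /p big_ord_recr /=; ring.
rewrite normrM; apply: le_trans (ler_pM _ _ (ple n) (fc n)) _ => //.
by rewrite (exprMn n z y) mulrACA lexx.
Qed.

(** * Infinite q-Pochhammer symbols *)

Section Pochhammer.
Variable q : K.
Hypothesis q1 : `|q| < 1.

Lemma cvgn_qpochn a : qpochn a q @ \oo --> qpoch_inf a q.
Proof.
apply: (@cvgn_prod (fun m => - (a * q ^+ m)) `|a| `|q|) => // n.
by rewrite normrN normrM normrX.
Qed.

Lemma norm_factor_ge a m : `|a| < 1 -> 1 - `|a| <= `|1 - a * q ^+ m|.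
Proof.
move=> a1; apply: le_trans (lerB_dist _ _); rewrite normr1 lerD2l lerN2.
by rewrite normrM ler_piMr // normrX exprn_ile1 // ltW.
Qed.

Lemma factor_neq0 a m : `|a| < 1 -> 1 - a * q ^+ m != 0.
Proof.
move=> a1; rewrite -normr_gt0; apply: lt_le_trans (norm_factor_ge m a1).
by rewrite subr_gt0.
Qed.

Lemma qpochn_neq0 a n : `|a| < 1 -> qpochn a q n != 0.
Proof. by move=> a1; apply/prodf_neq0 => m _; exact: factor_neq0. Qed.

Lemma nonroot_lt1 : nonroot q.
Proof. by move=> n; rewrite exprS factor_neq0. Qed.

(** The product of the inverse factors 1 + f m converges as well, and the two limits multiply to
    1. *)
Lemma qpoch_inf_neq0 a : `|a| < 1 -> qpoch_inf a q != 0.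
Proof.
move=> a1; pose f m := a * q ^+ m / (1 - a * q ^+ m).
have fE m : 1 + f m = (1 - a * q ^+ m)^-1.
  have := factor_neq0 m a1; rewrite /f; set u := 1 - _ => u0.
  have -> : a * q ^+ m = 1 - u by rewrite subKr.
  by field.
have a1' : 0 < 1 - `|a| by rewrite subr_gt0.
have /cvgn_prod : forall m, `|f m| <= `|a| / (1 - `|a|) * `|q| ^+ m.
  move=> m; rewrite /f !normrM normfV normrX [X in _ <= X]mulrAC ler_wpM2l ?mulr_ge0 ?exprn_ge0 //.
  by rewrite lef_pV2 ?posrE ?normr_gt0 ?factor_neq0 // norm_factor_ge.
move=> /(_ (divr_ge0 (normr_ge0 a) (ltW a1')) (normr_ge0 q) q1) fcvg.
have := cvgM (cvgn_qpochn (a := a)) fcvg; set v := lim _ => uv.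
have : (fun n : nat => 1 : K) @ \oo --> qpoch_inf a q * v.
  have -> : (fun=> 1) = qpochn a q \* (fun n => \prod_(m < n) (1 + f m)).
    apply/funext => n; rewrite /= -big_split /= big1 // => m _.
    by rewrite fE mulfV ?factor_neq0.
  exact: uv.
move=> /(cvgn_uniq (cvg_cst (1 : K))) /eqP; apply: contraTneq => ->.
by rewrite mul0r oner_eq0.
Qed.

Lemma qpoch_inf_split a n : qpoch_inf a q = qpochn a q n * qpoch_inf (a * q ^+ n) q.
Proof.
have h : (fun m => qpochn a q (m + n)%N) @ \oo --> qpochn a q n * qpoch_inf (a * q ^+ n) q.
  have -> : (fun m => qpochn a q (m + n)%N)
      = (fun m => qpochn a q n * qpochn (a * q ^+ n) q m).
    apply/funext => m; rewrite /qpochn addnC big_split_ord /=; congr (_ * _).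
    by apply: eq_bigr => i _; rewrite exprD mulrA.
  by apply: cvgM; [exact: cvg_cst | exact: cvgn_qpochn].
by move: h; rewrite cvg_shiftn; apply: cvgn_uniq; exact: cvgn_qpochn.
Qed.

Lemma qpochE a n : `|a| < 1 -> qpoch a q n = qpochn a q n.
Proof.
move=> a1; rewrite /qpoch (qpoch_inf_split a n) mulfK // qpoch_inf_neq0 //.
by rewrite (le_lt_trans _ a1) // normrM ler_piMr // normrX exprn_ile1 // ltW.
Qed.

Lemma cvgn_iqfact : iqfact q @ \oo --> (qpoch_inf q q)^-1.
Proof. by apply: cvgV; [exact: qpoch_inf_neq0 | exact: cvgn_qpochn]. Qed.

Lemma iqfact_bounded : exists2 B, 0 <= B & forall n, `|iqfact q n| <= B.
Proof. apply: cvgn_bounded; apply: cvgP; exact: cvgn_iqfact. Qed.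

Lemma cvgn_bkernel e m : bkernel q e m @ \oo --> (qpoch_inf q q)^-1 ^+ 2.
Proof.
rewrite -(cvg_shiftn m) expr2.
have -> : (fun n => bkernel q e m (n + m)%N)
  = (fun n => iqfact q n * iqfact q (n + (m + m + e))%N).
  by apply/funext => n; rewrite /bkernel leq_addl addnK !addnA.
by apply: cvgM; [exact: cvgn_iqfact | rewrite cvg_shiftn; exact: cvgn_iqfact].
Qed.

Lemma bkernel_bounded e : exists2 B, 0 <= B & forall m n, `|bkernel q e m n| <= B.
Proof.
have [B B0 BP] := iqfact_bounded; exists (B * B) => [|m n]; first exact: mulr_ge0.
rewrite /bkernel; case: leqP => _; last by rewrite normr0 mulr_ge0.
by rewrite normrM ler_pM.
Qed.

End Pochhammer.

(** Dominated convergence: the terms below S form a finite sum of null sequences, and the others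
    contribute at most c y^S / (1 - y), uniformly in n. *)
Lemma tannery (w : nat -> nat -> K) c y : 0 <= c -> 0 <= y -> y < 1 ->
  (forall n s, `|w n s| <= c * y ^+ s) ->
  (forall s, (fun n => w n s) @ \oo --> (0 : K)) ->
  (fun n => \sum_(s < n.+1) w n s) @ \oo --> (0 : K).
Proof.
move=> c0 y0 y1 wc w0; apply/cvgn_distP => e e0.
have e2 : 0 < e / 2 by rewrite divr_gt0.
have y1' : 0 < 1 - y by rewrite subr_gt0.
have [S SP] := expr_small (divr_ge0 c0 (ltW y1')) y0 y1 e2.
have := cvgn_sum (f := fun s n => w n s) (M := S) (fun s _ => w0 s).
rewrite big1 // => /cvgn_distP /(_ _ e2) [N NP].
exists (maxn S N) => n; rewrite geq_max => /andP[leSn leNn].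
rewrite sub0r normrN -(big_mkord xpredT (w n)) (big_cat_nat (n := S)) ?leqW //=.
rewrite [e]splitr; apply: (le_lt_trans (ler_normD _ _)); apply: ltrD.
  by have := NP _ leNn; rewrite sub0r normrN big_mkord.
apply: le_lt_trans (SP S (leqnn S)); apply: (le_trans (ler_norm_sum _ _ _)).
apply: (@le_trans _ _ (c * \sum_(S <= s < n.+1) y ^+ s)).
  by rewrite mulr_sumr ler_sum.
rewrite mulrAC -[X in _ <= X]mulrA ler_wpM2l //; exact: geometric_tail.
Qed.

Lemma cvgn_norm_le u l c : (forall n, `|u n| <= c) -> u @ \oo --> l -> `|l| <= c.
Proof.
move=> uc /cvgn_distP ul; have c0 := le_trans (normr_ge0 _) (uc 0%N).
rewrite real_leNgt ?ger0_real //; apply/negP => ltcl.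
have e0 : 0 < `|l| - c by rewrite subr_gt0.
have [N /(_ N (leqnn N))] := ul _ e0; apply/negP.
rewrite -real_leNgt ?ger0_real ?(ltW e0) // lerBlDr.
rewrite -{1}[l](subrK (u N)); apply: (le_trans (ler_normD _ _)).
by rewrite lerD2l.
Qed.

Lemma cvgn_comp u l (g : nat -> nat) : (forall n, (n <= g n)%N) ->
  u @ \oo --> l -> (fun n => u (g n)) @ \oo --> l.
Proof.
move=> leg /cvgn_distP ul; apply/cvgn_distP => e /ul [N NP].
by exists N => n leNn; apply: NP; apply: leq_trans leNn (leg n).
Qed.

Lemma tannery_diff (u : nat -> nat -> K) (v : nat -> K) c y :
  0 <= c -> 0 <= y -> y < 1 ->
  (forall n s, `|u n s| <= c * y ^+ s) ->
  (forall s, (fun n => u n s) @ \oo --> v s) ->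
  (fun n => \sum_(s < n.+1) u n s - \sum_(s < n.+1) v s) @ \oo --> (0 : K).
Proof.
move=> c0 y0 y1 uc uv; under eq_fun do rewrite -sumrB.
apply: (tannery (w := fun n s => u n s - v s) (c := c + c) (y := y)) => //.
- exact: addr_ge0.
- move=> n s; rewrite mulrDl; apply: le_trans (ler_normB _ _) (lerD _ _) => //.
  exact: cvgn_norm_le (fun n => uc n s) (uv s).
- by move=> s; rewrite -[X in _ --> X](subrr (v s)); apply: cvgB (uv s) (cvg_cst _).
Qed.

(** An equivalence, since it is used both ways: to deduce the limit of a plain series from that of
    its kernel-weighted sums, and conversely for the nested sum. *)
Lemma tannery_cvg (u : nat -> nat -> K) (v : nat -> K) c y l :
  0 <= c -> 0 <= y -> y < 1 ->
  (forall n s, `|u n s| <= c * y ^+ s) ->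
  (forall s, (fun n => u n s) @ \oo --> v s) ->
  (fun n => \sum_(s < n.+1) u n s) @ \oo --> l <->
  (fun n => \sum_(s < n.+1) v s) @ \oo --> l.
Proof.
move=> c0 y0 y1 uc uv; have d0 := tannery_diff c0 y0 y1 uc uv.
split=> h.
  by rewrite -[l]subr0; apply: cvgn_ext (cvgB h d0) => n; rewrite !fctE subKr.
by rewrite -[l]addr0; apply: cvgn_ext (cvgD h d0) => n; rewrite !fctE addrC subrK.
Qed.

(** Removes the truncation of the outermost sum: for fixed s the factor 1/(q;q)_(n-s) tends to
    1/(q;q)_oo. *)
Lemma cvgn_bstep_inv q w f c y l : `|q| < 1 -> 0 <= c -> 0 <= y -> y < 1 ->
  (forall s, `|w s * f s| <= c * y ^+ s) -> bstep q w f @ \oo --> l ->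
  (fun n => \sum_(s < n.+1) w s * f s) @ \oo --> qpoch_inf q q * l.
Proof.
move=> q1 c0 y0 y1 wfc wfl; have [B B0 BP] := iqfact_bounded q1.
have P0 := qpoch_inf_neq0 q1 q1; set P := qpoch_inf q q in P0 *.
have uB n s : `|w s * iqfact q (n - s) * f s| <= B * c * y ^+ s.
  by rewrite mulrAC mulrC normrM -mulrA; exact: ler_pM.
have uP s : (fun n => w s * iqfact q (n - s) * f s) @ \oo --> w s * P^-1 * f s.
  rewrite -(cvg_shiftn s); under eq_fun do rewrite addnK.
  by apply: cvgM (cvg_cst _); apply: cvgM (cvg_cst _) _; exact: cvgn_iqfact.
have h := (tannery_cvg l (mulr_ge0 B0 c0) y0 y1 uB uP).1 wfl.
apply: cvgn_ext (cvgM (cvg_cst P) h) => n.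
rewrite /= mulr_sumr; apply: eq_bigr => s _.
by rewrite [w s * _]mulrC -[_ * w s * _]mulrA mulVKf.
Qed.

(** The Jacobi triple product. In the finite form each kernel tends to 1/(P;P)_oo^2, while the
    right-hand side retains one factor 1/(P;P)_oo. *)
Lemma cvgn_jpair X Y y : y < 1 -> `|X| <= y -> `|Y| <= y -> let P := X * Y in
  (fun n => \sum_(m < n.+1) jpair P X Y m) @ \oo -->
    qpoch_inf P P * qpoch_inf X P * qpoch_inf Y P.
Proof.
move=> y1 Xy Yy P; have y0 : 0 <= y := le_trans (normr_ge0 X) Xy.
have P1 : `|P| < 1.
  rewrite normrM; apply: (le_lt_trans _ y1); rewrite -[y]mulr1 ler_pM //.
  exact: (le_trans Yy (ltW y1)).
have [B B0 BP] := bkernel_bounded P1 1.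
have pairs n := finite_triple_product_pairs (nonroot_lt1 P1) n (erefl (X * Y)).
set l := _ * _ * _.
have P0 := qpoch_inf_neq0 P1 P1.
pose i := (qpoch_inf P P)^-1.
have hl : (fun n => \sum_(m < n.+1) jpair P X Y m * bkernel P 1 m n) @ \oo
    --> l * i ^+ 2.
  under eq_fun do rewrite pairs.
  have -> : l * i ^+ 2 = qpoch_inf X P * qpoch_inf Y P * i.
    rewrite /l /i; move: (qpoch_inf P P) P0 => p p0; field; exact: p0.
  apply: cvgM; first apply: cvgM.
  - exact: cvgn_qpochn.
  - by rewrite (cvg_shiftS (qpochn Y P)); exact: cvgn_qpochn.
  - apply: (cvgn_comp (g := fun n => (n + n.+1)%N)) => [n|]; first by lia.
    exact: cvgn_iqfact.
have jle m : `|jpair P X Y m| <= 2 * y ^+ m.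
  rewrite /jpair -mulrA normrM normrX normrN1 expr1n mul1r normrM.
  rewrite -[2 * _]mul1r; apply: ler_pM => //.
    by rewrite normrX exprn_ile1 // ltW.
  rewrite mulr_natl mulr2n; apply: le_trans (ler_normB _ _) (lerD _ _).
    by rewrite normrX; apply: lerXn2r; rewrite ?nnegrE.
  rewrite normrM !normrX exprS -mulrA -[y ^+ m]mul1r; apply: ler_pM => //.
  - by rewrite mulr_ge0 ?exprn_ge0.
  - exact: le_trans Yy (ltW y1).
  - rewrite -[y ^+ m]mulr1; apply: ler_pM; rewrite ?exprn_ge0 //.
      by apply: lerXn2r; rewrite ?nnegrE.
    by rewrite exprn_ile1 // ltW.
have uB n m : `|jpair P X Y m * bkernel P 1 m n| <= 2 * B * y ^+ m.
  by rewrite normrM mulrAC; apply: ler_pM.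
have uP m : (fun n => jpair P X Y m * bkernel P 1 m n) @ \oo
    --> jpair P X Y m * i ^+ 2.
  by apply: cvgM (cvg_cst _) _; exact: cvgn_bkernel.
have h' := (tannery_cvg _ (mulr_ge0 (ler0n _ 2) B0) y0 y1 uB uP).1 hl.
have -> : l = l * i ^+ 2 * qpoch_inf P P ^+ 2.
  by rewrite -mulrA -exprMn mulVf // expr1n mulr1.
apply: cvgn_ext (cvgM h' (cvg_cst (qpoch_inf P P ^+ 2))) => n.
by rewrite /= -mulr_suml -mulrA -exprMn mulVf // expr1n mulr1.
Qed.

End Limits.

(** * Limit of the nested sum *)

Section NestedSumLimit.
Variables (K : numFieldType) (q : K).
Hypothesis K_complete : geometrically_complete K.
Hypothesis q1 : `|q| < 1.
Local Notation Q := (q ^+ 2).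

Lemma norm_exprn_lt1 n : `|q ^+ n.+1| < 1.
Proof. by rewrite normrX exprn_ilt1. Qed.

Definition theta_limit d r a b : K :=
  let P := q ^+ (4 * (a + b + d + r) + 4) in
  qpochs_inf [:: P; q ^+ (2 * d + 3 + 4 * b); q ^+ (2 * d + 4 * r + 1 + 4 * a)] P
  + q * qpochs_inf [:: P; q ^+ (2 * d + 1 + 4 * b);
                       q ^+ (2 * d + 4 * r + 3 + 4 * a)] P.

Lemma cvgn_theta_pair d r a b :
  (fun n => \sum_(m < n.+1) theta_pair q d r a b m) @ \oo --> theta_limit d r a b.
Proof.
have qle n : `|q ^+ n.+1| <= `|q|.
  by rewrite normrX exprS ler_piMr // exprn_ile1 // ltW.
have jlim A B : let P := q ^+ (A.+1 + B.+1) in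
    (fun n => \sum_(m < n.+1) jpair P (q ^+ A.+1) (q ^+ B.+1) m) @ \oo -->
    qpochs_inf [:: P; q ^+ B.+1; q ^+ A.+1] P.
  move=> P; rewrite /P exprD /qpochs_inf !big_cons big_nil mulr1 mulrA mulrAC.
  exact (cvgn_jpair K_complete q1 (qle A) (qle B)).
rewrite /theta_limit.
apply: (cvgn_ext (u := (fun n => \sum_(m < n.+1) jpair _ _ _ m) \+
   (fun n => q * \sum_(m < n.+1) jpair _ _ _ m))); last first.
  apply: cvgD; last apply: cvgM (cvg_cst _) _.
    have := jlim (2 * d + 4 * r + 4 * a)%N (2 * d + 2 + 4 * b)%N.
    have -> : ((2 * d + 4 * r + 4 * a).+1 + (2 * d + 2 + 4 * b).+1
       = 4 * (a + b + d + r) + 4)%N by lia.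
    have -> : ((2 * d + 4 * r + 4 * a).+1 = 2 * d + 4 * r + 1 + 4 * a)%N by lia.
    have -> : ((2 * d + 2 + 4 * b).+1 = 2 * d + 3 + 4 * b)%N by lia.
    exact.
  have := jlim (2 * d + 4 * r + 2 + 4 * a)%N (2 * d + 4 * b)%N.
  have -> : ((2 * d + 4 * r + 2 + 4 * a).+1 + (2 * d + 4 * b).+1
     = 4 * (a + b + d + r) + 4)%N by lia.
  have -> : ((2 * d + 4 * r + 2 + 4 * a).+1 = 2 * d + 4 * r + 3 + 4 * a)%N by lia.
  have -> : ((2 * d + 4 * b).+1 = 2 * d + 1 + 4 * b)%N by lia.
  exact.
by move=> n /=; rewrite mulr_sumr -big_split.
Qed.

Lemma norm_geom_le (x y : K) j : `|x| <= 1 -> `|y| <= 1 -> `|geom x y j| <= j%:R.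
Proof.
move=> x1 y1; apply: (le_trans (ler_norm_sum _ _ _)).
rewrite -[X in X%:R](card_ord j) -sum1_card natr_sum; apply: ler_sum => i _.
by rewrite normrM !normrX mulr_ile1 ?exprn_ge0 ?exprn_ile1.
Qed.

Let Q1 : `|Q| < 1 := norm_exprn_lt1 1.
Let i2 : K := (qpoch_inf Q Q)^-1 ^+ 2.

Let Qx1 n e : `|Q ^+ n ^+ e| <= 1.
Proof. by rewrite !normrX !exprn_ile1 ?exprn_ge0 // ltW. Qed.

Let Qn1 n : `|Q ^+ n| <= 1.
Proof. by have := Qx1 n 1; rewrite expr1. Qed.

Lemma norm_geomQ_le m j : `|geomQ q m j| <= j%:R.
Proof. exact: norm_geom_le. Qed.

(** The component along Q^n K_m dies in the limit; the j + 1 terms of the remaining [geomQ] are the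
    origin of the sum over s in the theorem. *)
Lemma cvgn_theta_block j d m : theta_block q j d m @ \oo -->
  Q ^+ (m * m) ^+ d * geomQ q m j.+1 * i2.
Proof.
rewrite -mulrA; apply: cvgM (cvg_cst _) _; apply: cvgM; last first.
  exact: cvgn_bkernel.
rewrite -[X in _ --> X]subr0; apply: cvgB (cvg_cst _) _.
rewrite -[X in _ --> X](mul0r (geomQ q m j)); apply: cvgM _ (cvg_cst _).
apply: (cvgn_comp (u := fun n => Q ^+ n) (g := fun n => (m * m + n)%N)) => [n|].
  exact: leq_addl.
exact: cvgn_expr.
Qed.

Lemma cvgn_nested_sum j d r : nested_sum q j d r @ \oo -->
  i2 / (1 + q) * \sum_(i < j.+1) theta_limit d r i (j - i).
Proof.
have q0 : 1 + q != 0 by have := factor_neq0 q1 0 (a := - q); rewrite normrN mulNr opprK mulr1 => ->.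
have [B B0 BP] := bkernel_bounded K_complete Q1 0.
pose u n m : K := gcoef q m / (1 + q) * Q ^+ (m * m + m) ^+ r
  * (theta_block q j d m n - Q ^+ (m + m).+1 * theta_block q j d m.+1 n).
pose W m : K := Q ^+ (m * m) ^+ d * geomQ q m j.+1 * i2.
pose v m : K := gcoef q m / (1 + q) * Q ^+ (m * m + m) ^+ r
  * (W m - Q ^+ (m + m).+1 * W m.+1).
have tbB m n : `|theta_block q j d m n| <= (j.+1%:R + j%:R) * B.
  rewrite normrM -[leRHS]mul1r ler_pM // normrM ler_pM //.
  apply: le_trans (ler_normB _ _) (lerD _ _); first exact: norm_geomQ_le.
  by rewrite normrM -[leRHS]mul1r ler_pM // norm_geomQ_le.
(* All the decay in m comes from [gcoef], whose exponent is at least m; the other factors are merely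
   bounded. *)
have gB m : `|gcoef q m| <= 2 * `|q| ^+ m.
  rewrite /gcoef -mulrA normrM normrX normrN1 expr1n mul1r normrM mulrC ler_pM //.
    apply: le_trans (ler_normD _ _) _; rewrite normr1 [leRHS]mulr2n lerD2l.
    by rewrite normrX exprn_ile1 // ltW.
  by rewrite normrX exprD ler_piMl ?exprn_ge0 // exprn_ile1 // ltW.
pose c : K := 2 / `|1 + q| * ((j.+1%:R + j%:R) * B + (j.+1%:R + j%:R) * B).
have c0 : 0 <= c by rewrite mulr_ge0 ?divr_ge0 ?addr_ge0 ?mulr_ge0 ?addr_ge0.
have uB n m : `|u n m| <= c * `|q| ^+ m.
  rewrite /u /c normrM [leRHS]mulrAC ler_pM //; last first.
    apply: le_trans (ler_normB _ _) (lerD _ _) => //.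
    by rewrite normrM -[leRHS]mul1r ler_pM.
  rewrite normrM -[leRHS]mulr1 ler_pM // normrM normfV mulrAC ler_pM //.
  by rewrite invr_ge0.
have uv m : (fun n => u n m) @ \oo --> v m.
  apply: cvgM (cvg_cst _) _; apply: cvgB; first exact: cvgn_theta_block.
  by apply: cvgM (cvg_cst _) _; exact: cvgn_theta_block.
have vE m : v m = i2 / (1 + q) * \sum_(i < j.+1) theta_pair q d r i (j - i) m.
  have -> : v m = i2 / (1 + q) * (gcoef q m * Q ^+ (m * m + m) ^+ r
      * (Q ^+ (m * m) ^+ d * geomQ q m j.+1
         - Q ^+ (m + m).+1 * (Q ^+ (m.+1 * m.+1) ^+ d * geomQ q m.+1 j.+1))).
    by rewrite /v /W; ring.
  (* Q^(m^2+m) is the second base of the geometric sum at m and the first base at m + 1; reversing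
     the latter sum aligns its powers. *)
  congr (_ * _); rewrite {2}/geomQ /geom (reindex_inj rev_ord_inj) /=.
  rewrite /geomQ /geom !mulr_sumr -sumrB mulr_sumr; apply: eq_bigr => i _.
  rewrite subSS subKn; last by rewrite -ltnS.
  exact: theta_pairE.
have lim_v : (fun n => \sum_(m < n.+1) v m) @ \oo -->
    i2 / (1 + q) * \sum_(i < j.+1) theta_limit d r i (j - i).
  apply: (cvgn_ext (u := fun n => i2 / (1 + q) * \sum_(i < j.+1)
      \sum_(m < n.+1) theta_pair q d r i (j - i) m)).
    by move=> n; rewrite exchange_big mulr_sumr; apply: eq_bigr => m _; rewrite vE.
  apply: cvgM (cvg_cst _) _.
  apply: (cvgn_sum (f := fun i n => \sum_(m < n.+1) theta_pair q d r i (j - i) m)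
    (l := fun i => theta_limit d r i (j - i))) => i _.
  exact: cvgn_theta_pair.
apply: cvgn_ext ((tannery_cvg K_complete _ c0 (normr_ge0 q) q1 uB uv).2 lim_v) => n.
by rewrite (nested_sumE (nonroot_lt1 Q1) j d r (ltnSn n)).
Qed.

End NestedSumLimit.

(** * Sums over chains *)

Fixpoint chains l n : seq (seq nat) :=
  if l is l'.+1 then [seq s :: c | s <- iota 0 n.+1, c <- chains l' s]
  else [:: [::]].

Lemma chainsS l n :
  chains l.+1 n = [seq s :: c | s <- iota 0 n.+1, c <- chains l s].
Proof. by []. Qed.

Lemma mem_chains l n c : (c \in chains l n) = (size c == l) && path geq n c.
Proof.
elim: l n c => [|l IHl] n c; first by rewrite inE; case: c.
rewrite chainsS; apply/allpairsPdep/idP => [[s [t [sn tl ->]]]|].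
  by move: sn tl; rewrite mem_iota IHl ltnS /= eqSS => -> /andP[-> ->].
case: c => // s t /and3P[st sn pt].
by exists s, t; rewrite mem_iota IHl -eqSS st ltnS.
Qed.

Lemma chains_uniq l n : uniq (chains l n).
Proof.
elim: l n => // l IHl n; rewrite chainsS.
apply: allpairs_uniq_dep => [|s _|[s t] [s' t'] _ _ /= [-> ->]] //.
exact: iota_uniq.
Qed.

Lemma sum_chains (V : nmodType) (f : seq nat -> V) l n :
  \sum_(c <- chains l.+1 n) f c = \sum_(s < n.+1) \sum_(t <- chains l s) f (val s :: t).
Proof.
rewrite chainsS big_allpairs_dep -(big_mkord xpredT (fun s => \sum_(t <- chains l s) f (s :: t))).
by rewrite /index_iota subn0.
Qed.

Section HasSumChains.
Variable K : numFieldType.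
Hypothesis K_complete : geometrically_complete K.

(** A finite set containing all chains with first entry at most N changes the sum over these by at
    most the norms of chains with larger first entry, a geometric tail. *)
Lemma has_sum_chains l (f : seq nat -> K) c y L : 0 <= c -> 0 <= y -> y < 1 ->
  (forall s, \sum_(t <- chains l s) `|f (s :: t)| <= c * y ^+ s) ->
  (fun n => \sum_(s < n.+1) \sum_(t <- chains l s) f (val s :: t)) @ \oo --> L ->
  has_sum (fun s : chain l.+1 => f (val (val s))) L.
Proof.
move=> c0 y0 y1 fc /cvgn_distP fL.
have FF : Filter (@totally (chain l.+1)) := totally_filter.
apply/cvgrPdist_lt => e e0.
have e2 : 0 < e / 2 by rewrite divr_gt0.
have y1' : 0 < 1 - y by rewrite subr_gt0.
have [N1 N1P] := fL _ e2.
have [N2 N2P] := expr_small K_complete (divr_ge0 c0 (ltW y1')) y0 y1 e2.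
pose N := maxn N1 N2.
pose toC s : seq (chain l.+1) := pmap insub (pmap insub s : seq (l.+1.-tuple nat)).
exists [fset x in toC (chains l.+1 N)]%fset => // B /= /fsubsetP sub.
pose U := [seq val (val x) | x <- enum_fset B].
have -> : partial_sum (fun s : chain l.+1 => f (val (val s))) B = \sum_(c <- U) f c.
  by rewrite /partial_sum -(big_seq_fsetE _ _ xpredT (fun s : chain l.+1 => f (val (val s)))) big_map.
have U_uniq : uniq U by rewrite map_inj_uniq ?fset_uniq // => a b /val_inj /val_inj.
have subU c' : c' \in chains l.+1 N -> c' \in U.
  move=> c'N; have := c'N; rewrite mem_chains => /andP[sz pt].
  have st : sorted geq c' by case: (c') pt => //= a b /andP[].
  pose x : chain l.+1 := exist _ (Tuple sz) st.
  apply/mapP; exists x => //; apply: sub.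
  by rewrite !inE /= !mem_pmap_sub.
(* M is large enough for the chains bounded by M to contain all of B, so that all sums are compared
   inside one finite list. *)
pose M := maxn N (\max_(c' <- U) head 0%N c').
have U_M c' : c' \in U -> c' \in chains l.+1 M.
  move=> c'U; have : (head 0%N c' <= M)%N.
    rewrite /M leq_max; apply/orP; right.
    exact: (leq_bigmax_seq (F := head 0%N)).
  case/mapP: c'U => x _ ->; rewrite mem_chains size_tuple eqxx /=.
  by case: x => [[[|a b] sz] st] //= leM; apply/andP.
have sumU : \sum_(c' <- U) f c' = \sum_(c' <- chains l.+1 M | c' \in U) f c'.
  rewrite -[RHS]big_filter; apply: perm_big; apply: uniq_perm => //.
    exact: filter_uniq (chains_uniq _ _).
  by move=> c'; rewrite mem_filter; apply/idP/andP => [c'U|[]//]; rewrite U_M.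
have leNM : (N <= M)%N by rewrite leq_maxl.
have N_M c' : c' \in chains l.+1 N -> c' \in chains l.+1 M.
  by move/subU/U_M.
have sumN (g : seq nat -> K) : \sum_(c' <- chains l.+1 N) g c'
    = \sum_(c' <- chains l.+1 M | c' \in chains l.+1 N) g c'.
  rewrite -[RHS]big_filter; apply: perm_big; apply: uniq_perm.
  - exact: chains_uniq.
  - exact: filter_uniq (chains_uniq _ _).
  by move=> c'; rewrite mem_filter; apply/idP/andP => [c'N|[]//]; rewrite N_M.
have tail : \sum_(c' <- chains l.+1 M | c' \notin chains l.+1 N) `|f c'| < e / 2.
  have -> : \sum_(c' <- chains l.+1 M | c' \notin chains l.+1 N) `|f c'|
     = \sum_(c' <- chains l.+1 M) `|f c'| - \sum_(c' <- chains l.+1 N) `|f c'|.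
    rewrite (sumN (fun c' => `|f c'|)) [in RHS](bigID (mem (chains l.+1 N))) /=.
    by rewrite addrAC subrr add0r.
  rewrite !sum_chains -!(big_mkord xpredT (fun s => \sum_(t <- chains l s) `|f (s :: t)|)).
  rewrite (big_cat_nat (leq0n N.+1) (leNM : (N.+1 <= M.+1)%N)) /= addrAC subrr add0r.
  apply: (le_lt_trans _ (N2P N.+1 (leqW (leq_maxr _ _)))).
  rewrite mulrAC -mulrA; apply: le_trans (ler_wpM2l c0 (geometric_tail N.+1 M.+1 y0 y1)).
  by rewrite mulr_sumr; apply: ler_sum.
rewrite [e]splitr -[L](subrK (\sum_(c' <- chains l.+1 N) f c')) -addrA.
apply: (le_lt_trans (ler_normD _ _)); apply: ltrD.
  by rewrite sum_chains; apply: N1P; rewrite leq_maxl.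
apply: le_lt_trans tail; rewrite distrC sumU (sumN f).
rewrite (bigID (mem (chains l.+1 N))) /=.
have -> : \sum_(c' <- chains l.+1 M | (c' \in U) && (c' \in chains l.+1 N)) f c'
    = \sum_(c' <- chains l.+1 M | c' \in chains l.+1 N) f c'.
  apply: eq_bigl => c'; apply/andP/idP => [[]//|c'N]; by rewrite subU.
rewrite addrAC subrr add0r; apply: (le_trans (ler_norm_sum _ _ _)).
rewrite big_mkcond [leRHS]big_mkcond; apply: ler_sum => c' _.
by case: (c' \in U); case: (c' \in chains l.+1 N); rewrite ?normr_ge0 ?lexx.
Qed.

End HasSumChains.

(** * The iterated steps as sums over chains *)

Section ChainTerms.
Variables (K : numFieldType) (q : K) (j d r : nat).
Local Notation Q := (q ^+ 2).
Local Notation ip := (iqfact Q).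
(* [l] counts the entries from the current one to the last, so that the
   extra linear terms depend on [l] only. *)
Definition entry_exp l s : nat :=
  (s * s - (if r + d < l then s else 0) + (if l <= r then s else 0))%N.

Definition entry_weight l s : K := Q ^+ entry_exp l s.

Fixpoint level l : nat -> K :=
  if l is l'.+1 then bstep Q (entry_weight l) (level l') else beta0 q.

Fixpoint chain_term n (c : seq nat) : K :=
  if c is s :: c' then entry_weight (size c) s * ip (n - s) * chain_term s c'
  else beta0 q n.

Lemma level_chains l n : level l n = \sum_(c <- chains l n) chain_term n c.
Proof.
elim: l n => [|l IHl] n; first by rewrite big_seq1.
rewrite sum_chains [LHS]/= /bstep; apply: eq_bigr => s _; rewrite IHl mulr_sumr.
rewrite big_seq [RHS]big_seq; apply: eq_bigr => t.
by rewrite mem_chains => /andP[/eqP sz _]; rewrite /= sz.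
Qed.

Lemma level_nested_sum : level (j + (d + r)) = nested_sum q j d r.
Proof.
have base l : (l <= r)%N -> level l = iter l (bstep Q (up_weight q 1)) (beta0 q).
  elim: l => //= l IHl ltlr; rewrite IHl ?(ltnW ltlr) //.
  congr bstep; apply/funext => s; rewrite /entry_weight /entry_exp ltlr.
  by rewrite ltnNge (leq_trans ltlr) ?leq_addr // subn0 /up_weight mul1n.
have middle l : (l <= d)%N -> level (l + r)
    = iter l (bstep Q (up_weight q 0)) (iter r (bstep Q (up_weight q 1)) (beta0 q)).
  elim: l => [_|l IHl ltld] /=; first exact: base.
  rewrite IHl ?(ltnW ltld) //; congr bstep; apply/funext => s.
  rewrite /entry_weight /entry_exp /up_weight; congr (_ ^+ _).
  have -> : (r + d < (l + r).+1)%N = false by lia.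
  have -> : ((l + r).+1 <= r)%N = false by lia.
  lia.
rewrite /nested_sum -(middle d) //; elim: j => //= l IHl.
rewrite IHl; congr bstep; apply/funext => s.
rewrite /entry_weight /entry_exp /down_weight; congr (_ ^+ _).
have -> : (r + d < (l + (d + r)).+1)%N by lia.
have -> : ((l + (d + r)).+1 <= r)%N = false by lia.
nia.
Qed.

Hypothesis K_complete : geometrically_complete K.
Hypothesis q1 : `|q| < 1.
Let Q1 : `|Q| < 1 := norm_exprn_lt1 q1 1.

(** Twice the exponent is at least s - 1, with equality at s = 1 for the third weight; hence the
    factor y^-1. A positive y replaces the norm of q, as q may be 0. *)
Lemma entry_weight_le l s y : `|q| <= y -> y < 1 -> 0 < y ->
  `|entry_weight l s| <= y^-1 * y ^+ s.
Proof.
move=> qy y1 y0; rewrite ler_pdivlMl // /entry_weight -exprM normrX.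
apply: (@le_trans _ _ (y * y ^+ (2 * entry_exp l s))).
  by rewrite ler_pM2l //; apply: lerXn2r; rewrite ?nnegrE ?(ltW y0).
rewrite -exprS; apply: ler_wiXn2l; rewrite ?(ltW y0) ?(ltW y1) //.
by rewrite /entry_exp; case: ifP; case: ifP; nia.
Qed.

Lemma beta0_bounded : exists2 B, 0 <= B & forall n, `|beta0 q n| <= B.
Proof.
apply: cvgn_bounded; apply: cvgP; apply: cvgM; first exact: cvgn_iqfact.
have Nq1 : `|- q| < 1 by rewrite normrN.
apply: cvgV; first exact: (qpoch_inf_neq0 K_complete Q1 Nq1).
exact: cvgn_qpochn.
Qed.

(** By induction on the length, the absolute sum over the inner entries is bounded uniformly in the
    outer one, whose weight supplies the geometric decay. *)
Lemma chain_terms_bounded : exists2 y, 0 <= y < 1 &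
  forall l, exists2 c, 0 <= c &
  forall l' s, \sum_(t <- chains l s) `|entry_weight l' s * chain_term s t| <= c * y ^+ s.
Proof.
have [y y0 /andP[qy y1]] : exists2 y, 0 < y & (`|q| <= y) && (y < 1).
  exists ((1 + `|q|) / 2); first by rewrite divr_gt0 // ltr_wpDr.
  rewrite ler_pdivlMr // ltr_pdivrMr // mul1r [_ * 2]mulr_natr !mulr2n.
  by rewrite lerD2r ltrD2l q1 ltW.
have y1' : 0 < 1 - y by rewrite subr_gt0.
exists y; first by rewrite ltW.
have [B B0 BP] := iqfact_bounded K_complete Q1.
have [B' B'0 B'P] := beta0_bounded.
have bound l : exists2 c, 0 <= c &
    forall s, \sum_(t <- chains l s) `|chain_term s t| <= c.
  elim: l => [|l [c c0 IHl]].
    by exists B' => // s; rewrite /= big_seq1; exact: B'P.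
  exists (y^-1 * B * c / (1 - y)) => [|n].
    by rewrite divr_ge0 ?(ltW y1') // !mulr_ge0 // invr_ge0 ltW.
  rewrite sum_chains.
  apply: (@le_trans _ _ (\sum_(s < n.+1) y^-1 * B * c * y ^+ s)).
    apply: ler_sum => s _.
    apply: (@le_trans _ _ (\sum_(t <- chains l s) y^-1 * y ^+ s * B * `|chain_term s t|)).
      apply: ler_sum => t _ /=; rewrite !normrM ler_wpM2r // ler_pM //.
      exact: entry_weight_le.
    rewrite -mulr_sumr [leRHS]mulrAC [_ * B * y ^+ s]mulrAC ler_wpM2l //.
    by rewrite !mulr_ge0 ?exprn_ge0 ?invr_ge0 ?(ltW y0).
  rewrite -mulr_sumr ler_wpM2l ?mulr_ge0 ?invr_ge0 ?(ltW y0) //.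
  rewrite -(big_mkord xpredT (fun s => y ^+ s)).
  by have := geometric_tail 0 n.+1 (ltW y0) y1; rewrite expr0 mul1r.
move=> l; have [c c0 cP] := bound l; exists (y^-1 * c).
  by rewrite mulr_ge0 ?invr_ge0 ?(ltW y0).
move=> l' s; apply: (@le_trans _ _ (\sum_(t <- chains l s) y^-1 * y ^+ s * `|chain_term s t|)).
  by apply: ler_sum => t _; rewrite normrM ler_wpM2r // entry_weight_le.
rewrite -mulr_sumr [leRHS]mulrAC ler_wpM2l // mulr_ge0 ?invr_ge0 ?exprn_ge0 //; exact: ltW.
Qed.

(** [level l.+1] is the multiple sum with truncated outermost entry; undoing the truncation costs
    (Q;Q)_oo, and the absolute bounds make the summation unconditional. *)
Lemma has_sum_chain_terms l L : level l.+1 @ \oo --> L ->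
  has_sum (fun s : chain l.+1 => let c := val (val s) in
     entry_weight l.+1 (head 0%N c) * chain_term (head 0%N c) (behead c))
    (qpoch_inf Q Q * L).
Proof.
move=> levL; have [y /andP[y0 y1] /(_ l) [c c0 cP]] := chain_terms_bounded.
pose f (c : seq nat) := entry_weight l.+1 (head 0%N c) * chain_term (head 0%N c) (behead c).
apply: (has_sum_chains K_complete (f := f) c0 y0 y1 (cP l.+1)).
have wle s : `|entry_weight l.+1 s * level l s| <= c * y ^+ s.
  apply: le_trans (cP l.+1 s); rewrite level_chains mulr_sumr.
  exact: ler_norm_sum.
apply: cvgn_ext (cvgn_bstep_inv K_complete Q1 c0 y0 y1 wle levL) => n.
by apply: eq_bigr => s _; rewrite level_chains mulr_sumr.
Qed.

End ChainTerms.

(** * Geometric completeness of the complex numbers *)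

Section ComplexComplete.
Variable R : realType.
Local Open Scope complex_scope.

Lemma real_geometric_cvg (a : nat -> R) (c y : R) : 0 <= y -> y < 1 ->
  (forall n, `|a n.+1 - a n| <= c * y ^+ n) -> cvgn a.
Proof.
move=> y0 y1 ac.
have c0 : 0 <= c by have := ac 0%N; rewrite mulr1; apply: le_trans.
have : cvgn (series (fun n => a n.+1 - a n) : nat -> R).
  apply: normed_cvg.
  apply: (@series_le_cvg _ _ (geometric c y)) => //= [n|].
    by rewrite mulr_ge0 ?exprn_ge0.
  by apply: is_cvg_geometric_series; rewrite ger0_norm.
move=> h; have -> : a = (fun=> a 0%N) + series (fun n => a n.+1 - a n).
  by apply/funext => n; rewrite !fctE /series /= telescope_sumr // addrC subrK.
exact: is_cvgD (is_cvg_cst _) h.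
Qed.

Lemma complex_geometrically_complete :
  geometrically_complete (R[i] : numFieldType).
Proof.
move=> u c y y0 y1 uc.
have c0 : 0 <= c by have := uc 0%N; rewrite mulr1; apply: le_trans.
(* y and c are complex numbers comparable with 0, hence real; the estimates for real and imaginary
   parts can run in R. *)
have [yr yE] := complex_realP _ (ger0_real y0).
have [cr cE] := complex_realP _ (ger0_real c0).
move: y0 y1; rewrite yE ler0c => y0; rewrite -[1]/(1%:C) ltcR => y1.
have cvg_part (p : R[i] -> R) : (forall z w, p (z - w) = p z - p w) ->
    (forall z, `|p z|%:C <= `|z|) ->
    cvgn (fun n => p (u n)).
  move=> pB ple; apply: (real_geometric_cvg (c := cr) y0 y1) => n.
  rewrite -pB -lecR; apply: le_trans (ple _) _; apply: le_trans (uc n) _.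
  by rewrite cE yE rmorphM rmorphXn.
have ReB (z w : R[i]) : complex.Re (z - w) = complex.Re z - complex.Re w.
  by case: z w => [a b] [a' b'].
have ImB (z w : R[i]) : complex.Im (z - w) = complex.Im z - complex.Im w.
  by case: z w => [a b] [a' b'].
have normR (x : R) : `|x%:C| = `|x|%:C.
  by rewrite normc_def /= expr0n addr0 sqrtr_sqr.
have normi : `|('i%C : R[i])| = 1.
  by rewrite normc_def /= expr0n expr1n add0r sqrtr1.
have ge_Im (z : R[i]) : `|complex.Im z|%:C <= `|z|.
  have := normc_ge_Re (z * 'i%C); rewrite ReiNIm normrN normrM.
  by rewrite normi mulr1.
have Re_cvg := cvg_part _ ReB (@normc_ge_Re R).
have Im_cvg := cvg_part _ ImB ge_Im.
pose l := lim ((fun n => complex.Re (u n)) @ \oo)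
   +i* lim ((fun n => complex.Im (u n)) @ \oo).
apply: (cvgP (l : (R[i] : numFieldType))); apply/cvgn_distP => e.
move=> e0; have [er eE] := complex_realP _ (ger0_real (ltW e0)).
move: e0; rewrite eE -[0]/(0%:C) ltcR => e0.
have e2 : 0 < er / 2 by rewrite divr_gt0.
have [N1 N1P] := (cvgn_distP _ _).1 Re_cvg _ e2.
have [N2 N2P] := (cvgn_distP _ _).1 Im_cvg _ e2.
exists (maxn N1 N2) => n; rewrite geq_max => /andP[le1 le2].
have /N1P lt1 := le1; have /N2P lt2 := le2.
rewrite [l - u n]complexE; apply: le_lt_trans (ler_normD _ _) _.
rewrite [er]splitr rmorphD; apply: ltrD.
  by rewrite normR ltcR ReB; exact: lt1.
by rewrite normrM normi mul1r normR ltcR ImB; exact: lt2.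
Qed.

End ComplexComplete.

(** * Identification of the summand *)

Section Summand.
Variables (K : numFieldType) (q : K) (j d r : nat).
Local Notation Q := (q ^+ 2).
Local Notation ip := (iqfact Q).

Lemma chain_termE n c : chain_term q d r n c
  = Q ^+ (\sum_(i < size c) entry_exp d r (size c - i) (nth 0%N c i))
    * \prod_(i < size c) ip (nth 0%N (n :: c) i - nth 0%N c i) * beta0 q (last n c).
Proof.
elim: c n => [|s c IHc] n; first by rewrite /= !big_ord0 !mul1r.
rewrite [LHS]/= IHc [size (s :: c)]/= !big_ord_recl /= subn0 exprD.
rewrite -[Q ^+ entry_exp _ _ _ _]/(entry_weight q d r (size c).+1 s).
by set u := Q ^+ _; set w := \prod_(i < _) _; ring.
Qed.

Lemma half_exponentE k (t : k.-tuple nat) : (k = j + (d + r))%N ->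
  half_exponent j r t = (\sum_(i < k) entry_exp d r (k - i) (nth 0%N t i))%N.
Proof.
move=> kE; rewrite /half_exponent !big_add1 /= addn1 big_add1 /= !big_mkord.
have tailE : (\sum_(k - r <= i < k) part t i.+1
    = \sum_(i < k) (if k - i <= r then nth 0 t i else 0))%N.
  rewrite (big_nat_widenl _ 0) // big_mkord big_mkcond; apply: eq_bigr => i _ /=.
  by have -> : (k - r <= i)%N = (k - i <= r)%N by have := ltn_ord i; lia.
have headE : (\sum_(i < j) part t i.+1
    = \sum_(i < k) (if r + d < k - i then nth 0 t i else 0))%N.
  rewrite (big_ord_widen k (fun i => part t i.+1)); last by rewrite kE leq_addr.
  rewrite big_mkcond; apply: eq_bigr => i _.
  by have -> : (i < j)%N = (r + d < k - i)%N by have := ltn_ord i; lia.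
rewrite tailE headE /entry_exp big_split /=; congr (_ + _)%N.
(* Adding the linear part back lets the subtraction of sums be checked termwise, where s <= s^2
   prevents truncation. *)
rewrite -[RHS](addnK (\sum_(i < k) (if r + d < k - i then nth 0 t i else 0))%N).
congr (_ - _)%N; rewrite -big_split /=; apply: eq_bigr => i _.
rewrite /part /= -mulnn; case: ifP => _; nia.
Qed.

Hypothesis K_complete : geometrically_complete K.
Hypothesis q1 : `|q| < 1.
Let Q1 : `|Q| < 1 := norm_exprn_lt1 q1 1.

Lemma summandE l (t : l.+1.-tuple nat) : (l.+1 = j + (d + r))%N ->
  summand j r q t = qpoch_inf (- q) Q
    * (entry_weight q d r l.+1 (head 0%N t) * chain_term q d r (head 0%N t) (behead t)).
Proof.
move=> lE; rewrite /summand half_exponentE //.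
have Nq1 : `|- q| < 1 by rewrite normrN.
have -> : qpoch_inf (- q ^+ (1 + 2 * part t l.+1)) Q
    = qpoch_inf (- q) Q / qpochn (- q) Q (part t l.+1).
  rewrite (qpoch_inf_split K_complete Q1 (- q) (part t l.+1)) mulrAC mulfV ?mul1r.
    by rewrite mulNr exprD expr1 exprM.
  exact: qpochn_neq0.
under eq_bigr do rewrite (qpochE K_complete Q1) //.
rewrite (qpochE K_complete Q1) // invfM exprM.
have sz : size (behead t) = l by rewrite size_behead size_tuple.
rewrite chain_termE sz.
have tE : head 0%N t :: behead t = t by case: t {lE sz} => -[].
have -> : \prod_(i < l) ip (nth 0%N (head 0%N t :: behead t) i - nth 0%N (behead t) i)
    = (\prod_(1 <= i < l.+1) qpochn Q Q (part t i - part t i.+1))^-1.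
  rewrite -prodfV tE big_add1 big_mkord; apply: eq_bigr => i _.
  by rewrite nth_behead.
have -> : last (head 0%N t) (behead t) = part t l.+1.
  by rewrite (last_nth 0%N) tE sz.
rewrite big_ord_recl subn0 nth0.
rewrite (eq_bigr (fun i : 'I_l => entry_exp d r (l - i) (nth 0%N (behead t) i))).
  by rewrite exprD /beta0 /iqfact /entry_weight; ring.
by move=> i _; rewrite nth_behead.
Qed.



End Summand.

Lemma has_sumZ (K : numFieldType) (I : choiceType) (f : I -> K) a L :
  has_sum f L -> has_sum (fun i => a * f i) (a * L).
Proof.
have FF : Filter (@totally I) := totally_filter.
rewrite /has_sum => fL.
have -> : partial_sum (fun i => a * f i) = (fun=> a) \* partial_sum f.
  by apply/funext => A; rewrite /= /partial_sum mulr_sumr.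
exact: cvgM (cvg_cst _) fL.
Qed.

(** The constants combine as follows: (Q;Q)_oo from undoing the truncation and (Q;Q)_oo^-2 from the
    kernels leave 1/(Q;Q)_oo, and the 1/(1+q) of the initial expansion turns (-q;Q)_oo into
    (-q^3;Q)_oo. *)
Lemma has_sum_summand (K : numFieldType) (q : K) (j r k : nat) :
  geometrically_complete K -> `|q| < 1 -> (1 <= k)%N -> (j + r <= k)%N ->
  has_sum (fun s : chain k => summand j r q (val s))
    (qpoch_inf (- q ^+ 3) (q ^+ 2) / qpoch_inf (q ^+ 2) (q ^+ 2)
     * \sum_(0 <= s < j.+1)
         (qpochs_inf [:: q ^+ (4 * k + 4);
                         q ^+ (2 * k + 3 - 2 * r + 2 * j - 4 * s);
                         q ^+ (2 * k + 1 + 2 * r - 2 * j + 4 * s)]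
                     (q ^+ (4 * k + 4))
          + q * qpochs_inf [:: q ^+ (4 * k + 4);
                               q ^+ (2 * k + 1 - 2 * r + 2 * j - 4 * s);
                               q ^+ (2 * k + 3 + 2 * r - 2 * j + 4 * s)]
                           (q ^+ (4 * k + 4)))).
Proof.
move=> K_complete q1 hk hjrk.
have Q1 := norm_exprn_lt1 q1 1.
case: k hk hjrk => // l _ jrl.
(* d counts the entries carrying neither linear term. Written with d, the exponents of the theorem
   show that none of their subtractions is truncated. *)
have [d lE] : exists d, (l.+1 = j + (d + r))%N by exists (l.+1 - (j + r))%N; lia.
have levL := @cvgn_nested_sum K q K_complete q1 j d r.
rewrite -level_nested_sum in levL.
rewrite -lE in levL.
move: (has_sum_chain_terms K_complete q1 levL).
set L := _ * (_ * _) => sumL.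
set L' := (X in has_sum _ X).
have -> : L' = qpoch_inf (- q) (q ^+ 2) * L.
  rewrite /L' /L; set P := qpoch_inf (q ^+ 2) (q ^+ 2).
  have P0 : P != 0 := qpoch_inf_neq0 K_complete Q1 Q1.
  have -> : qpoch_inf (- q) (q ^+ 2) = (1 + q) * qpoch_inf (- q ^+ 3) (q ^+ 2).
    rewrite (qpoch_inf_split K_complete Q1 (- q) 1) /qpochn big_ord1 mulr1 opprK.
    by rewrite expr1 mulNr -exprS.
  have q0 : 1 + q != 0.
    have Nq1 : `|- q| < 1 by rewrite normrN.
    by have := factor_neq0 Q1 0 Nq1; rewrite mulr1 opprK.
  transitivity (qpoch_inf (- q ^+ 3) (q ^+ 2) / P
      * \sum_(i < j.+1) theta_limit q d r i (j - i)).
    congr (_ * _); rewrite big_mkord; apply: eq_bigr => i _.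
    have lei : (i <= j)%N by rewrite -ltnS.
    rewrite /theta_limit.
    have -> : (4 * (i + (j - i) + d + r) + 4 = 4 * l.+1 + 4)%N by lia.
    have -> : (2 * d + 3 + 4 * (j - i) = 2 * l.+1 + 3 - 2 * r + 2 * j - 4 * i)%N by lia.
    have -> : (2 * d + 4 * r + 1 + 4 * i = 2 * l.+1 + 1 + 2 * r - 2 * j + 4 * i)%N by lia.
    have -> : (2 * d + 1 + 4 * (j - i) = 2 * l.+1 + 1 - 2 * r + 2 * j - 4 * i)%N by lia.
    have -> : (2 * d + 4 * r + 3 + 4 * i = 2 * l.+1 + 3 + 2 * r - 2 * j + 4 * i)%N by lia.
    by [].
  move: P P0 q0 (qpoch_inf _ _) (\sum_(_ < _) _) => P P0 q0 a S.
  by field; rewrite P0 q0.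
have -> : (fun s : chain l.+1 => summand j r q (val s)) = (fun s : chain l.+1 =>
    qpoch_inf (- q) (q ^+ 2) * (let c := val (val s) in
       entry_weight q d r l.+1 (head 0%N c) * chain_term q d r (head 0%N c) (behead c))).
  by apply/funext => s; exact: summandE.
exact: has_sumZ.
Qed.

Local Open Scope complex_scope.

Theorem theorem1p12 (R : realType) (q : R[i]) (j r k : nat)
    (hq : `|q| < 1) (hk : (1 <= k)%N) (hjrk : (j + r <= k)%N) :
  has_sum (fun s : chain k => summand j r q (val s))
    (qpoch_inf (- q ^+ 3) (q ^+ 2) / qpoch_inf (q ^+ 2) (q ^+ 2)
     * \sum_(0 <= s < j.+1)
         (qpochs_inf [:: q ^+ (4 * k + 4);
                         q ^+ (2 * k + 3 - 2 * r + 2 * j - 4 * s);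
                         q ^+ (2 * k + 1 + 2 * r - 2 * j + 4 * s)]
                     (q ^+ (4 * k + 4))
          + q * qpochs_inf [:: q ^+ (4 * k + 4);
                               q ^+ (2 * k + 1 - 2 * r + 2 * j - 4 * s);
                               q ^+ (2 * k + 3 + 2 * r - 2 * j + 4 * s)]
                           (q ^+ (4 * k + 4)))).
Proof.
exact: (has_sum_summand (@complex_geometrically_complete R) hq hk hjrk).
Qed.
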